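(* Let $(F,f)\colon (L'\rightrightarrows L'_N; H\rightrightarrows N)\to (L\rightrightarrows L_M; G\rightrightarrows M)$ be a VB-Morita map between LBGs, and let $\theta\in \Omega^1(M,L_M)$ be an $L_M$-valued $1$-form such that $\partial\theta=0$. Then, for all $y \in N$, $(F, f)$ induces a quasi-isomorphism between the Morita kernel of $\theta' :=F^{\ast}\theta \in \Omega^1(N,L'_N)$ at the point $y\in N$ and the Morita kernel of $\theta$ at the point $f(y)\in M$; namely, the cochain map with components $df\colon A_{H,y}\to A_{G,f(y)}$, $df\colon T_yN\to T_{f(y)}M$, $F\colon L'_{N,y}\to L_{M,f(y)}$ is a quasi-isomorphism.
   Context: Manifolds and maps are smooth; Lie groupoids are Hausdorff. For a Lie groupoid $G\rightrightarrows M$ write $s,t$ for source and target; $M$ is identified with the units; $A_G=\ker(ds)|_M$ is the Lie algebroid and $\rho_G=dt|_{A_G}\colon A_G\to TM$ the anchor. A Lie groupoid morphism $f\colon(H\rightrightarrows N)\to(G\rightrightarrows M)$ (same letter on arrows and objects) is a Morita map if (i) $H$ is, via $f$ and $(s,t)$, the fibre product of $(s,t)\colon G\to M\times M$ and $f\times f\colon N\times N\to M\times M$, and (ii) $\{(g,y)\in G\times N: s(g)=f(y)\}\to M$, $(g,y)\mapsto t(g)$, is a surjective submersion. A VB-groupoid (VBG) $(V\rightrightarrows V_M;G\rightrightarrows M)$ consists of Lie groupoids $V\rightrightarrows V_M$, $G\rightrightarrows M$ and vector bundles $V\to G$, $V_M\to M$ such that all structure maps of $V$ are vector bundle (VB)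 morphisms covering those of $G$. A VBG morphism $(F,f)$ consists of Lie groupoid morphisms $F\colon(W\rightrightarrows W_N)\to(V\rightrightarrows V_M)$, $f\colon(H\rightrightarrows N)\to(G\rightrightarrows M)$ with $F$ a VB morphism over $f$ on arrows and on objects; it is a VB-Morita map if $F$ is a Morita map. A line bundle-groupoid (LBG) is a VBG $(L\rightrightarrows L_M;G\rightrightarrows M)$ with $L\to G$, $L_M\to M$ line bundles; its structure maps are then fibrewise isomorphisms. VB-Morita maps between LBGs are fibrewise isomorphisms. For a fibrewise isomorphism $(F,f)\colon(E\to X)\to(E'\to X')$ and $\theta\in\Omega^k(X',E')$ put $(F^*\theta)_x(v_1,\dots)=F_x^{-1}(\theta_{f(x)}(df(v_1),\dots))$. For $\theta\in\Omega^k(M,L_M)$, $\partial\theta=s^*\theta-t^*\theta\in\Omega^k(G,L)$. For $\theta\in\Omega^1(M,L_M)$ with $\partial\theta=0$, the Morita kernel of $\theta$ at $x\in M$ is the complex $0\to A_{G,x}\xrightarrow{\rho_G}T_xM\xrightarrow{\theta}L_{M,x}\to0$ with non-trivial terms in degrees $-1,0,1$. *)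

(* Defs.v *)
From HB Require Import structures.
From mathcomp Require Export all_boot all_order all_algebra.
From mathcomp Require Export all_classical all_reals topology normedtype derive.

Set Implicit Arguments.
Unset Strict Implicit.
Unset Printing Implicit Defensive.

Import Order.TTheory GRing.Theory Num.Theory.
Import numFieldNormedType.Exports.

Local Open Scope classical_set_scope.
Local Open Scope ring_scope.

(** * Smooth maps between Euclidean spaces *)

(* [U] is always an open set.  C^(k+1) means: differentiable, with every
   directional derivative of class C^k. *)
Fixpoint Ck (R : realType) (m n k : nat) (U : set 'rV[R]_m)
    (f : 'rV[R]_m -> 'rV[R]_n) : Prop :=
  match k with
  | 0%N => forall x, U x -> {for x, continuous f}
  | k'.+1 => (forall x, U x -> differentiable f x) /\
             (forall v, Ck k' U (fun x => 'D_v f x))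
  end.

Definition Cinfty (R : realType) (m n : nat) (U : set 'rV[R]_m)
    (f : 'rV[R]_m -> 'rV[R]_n) : Prop := forall k, Ck k U f.

(** * Manifolds *)

(* A space with a preferred chart around each of its points: the chart at [x]
   is the restriction of [chart x] to [cdom x], with inverse [chart_inv x];
   the values of [chart x] and [chart_inv x] elsewhere are irrelevant.
   The axioms making these charts a smooth atlas come in [manifold]; keeping
   them apart lets one speak of smooth maps from and to a product. *)
Record charted (R : realType) := Charted {
  csort :> topologicalType;
  cdim : nat;
  cdom : csort -> set csort;
  chart : csort -> csort -> 'rV[R]_cdim;
  chart_inv : csort -> 'rV[R]_cdim -> csort }.

Record manifold (R : realType) := Manifold {
  mcharted :> charted R;
  _ : hausdorff_space mcharted;
  _ : second_countable (T := mcharted);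
  _ : forall x : mcharted, open (cdom x) /\ cdom x x;
  _ : forall x : mcharted, open (chart x @` cdom x);
  _ : forall x y : mcharted, cdom x y -> chart_inv x (chart x y) = y;
  _ : forall x y : mcharted, cdom x y -> {for y, continuous (chart x)};
  _ : forall x y : mcharted, cdom x y ->
        {for chart x y, continuous (chart_inv x)};
  _ : forall x x' : mcharted,
        Cinfty (chart x @` (cdom x `&` cdom x')) (chart x' \o chart_inv x) }.

Definition euclid (R : realType) (n : nat) : charted R :=
  @Charted R 'rV[R]_n n (fun=> setT) (fun=> id) (fun=> id).

Definition prodc (R : realType) (X Y : charted R) : charted R :=
  @Charted R (X * Y)%type (cdim X + cdim Y)
    (fun x => cdom x.1 `*` cdom x.2)
    (fun x y => row_mx (chart x.1 y.1) (chart x.2 y.2))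
    (fun x v => (chart_inv x.1 (lsubmx v), chart_inv x.2 (rsubmx v))).

Section SmoothMaps.
Context {R : realType}.

Definition in_charts (X Y : charted R) (f : X -> Y) (x : X) :
    'rV[R]_(cdim X) -> 'rV[R]_(cdim Y) :=
  chart (f x) \o f \o chart_inv x.

(* Smoothness on some neighbourhood of [x]. *)
Definition smooth_at (X Y : charted R) (f : X -> Y) (x : X) : Prop :=
  {for x, continuous f} /\
  exists U : set 'rV[R]_(cdim X),
    [/\ open U, U (chart x x), U `<=` chart x @` cdom x
      & Cinfty U (in_charts f x)].

Definition smooth (X Y : charted R) (f : X -> Y) : Prop :=
  forall x, smooth_at f x.

(* Smoothness on an arbitrary subset: existence of local smooth extensions. *)
Definition smooth_on (X Y : charted R) (S : set X) (f : X -> Y) : Prop :=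
  forall x, S x -> exists g : X -> Y,
    smooth_at g x /\ \forall w \near x, S w -> g w = f w.

(* The tangent space of [X] at [x] is the coordinate space of the chart at
   [x]; the tangent map is the differential in the charts at [x] and [f x]. *)
Definition tmap (X Y : charted R) (f : X -> Y) (x : X) :
    {linear 'rV[R]_(cdim X) -> 'rV[R]_(cdim Y)} :=
  'd (in_charts f x) (chart x x).

(* The coordinate vector field with constant components [v] in the chart at
   [x0], as a tangent vector at [x] (hence expressed in the chart at [x]). *)
Definition coord_field (X : charted R) (x0 : X) (v : 'rV[R]_(cdim X)) (x : X) :
    'rV[R]_(cdim X) :=
  'd (chart x \o chart_inv x0) (chart x0 x) v.

Definition submersion (X Y : charted R) (f : X -> Y) : Prop :=
  smooth f /\ forall x w, exists v, tmap f x v = w.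

(* [j] is a diffeomorphism onto the subset [S], whose smooth structure is the
   one induced by the ambient space: [j^-1] has local smooth extensions. *)
Definition diffeo_onto (P X : charted R) (j : P -> X) (S : set X) : Prop :=
  [/\ smooth j, injective j, range j = S
    & forall z, exists r : X -> P,
        smooth_at r (j z) /\ \forall w \near j z, S w -> j (r w) = w].

(* [P], with its maps [p] and [q], is the fibre product
   [{(x, y) | a x = b y}]. *)
Definition is_fibre_product (P X Y : charted R) (Z : Type)
    (p : P -> X) (q : P -> Y) (a : X -> Z) (b : Y -> Z) : Prop :=
  diffeo_onto (X := prodc X Y) (fun z => (p z, q z))
    [set w | a w.1 = b w.2].

End SmoothMaps.

(** * Vector bundles *)

(* The fibre over [b] is presented as a vector space [fib b] together with a
   bijection [incl b] onto the preimage of [b] under [proj]. *)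
Record vbundle (R : realType) (E B : manifold R) := VBundle {
  rank : nat;
  proj : E -> B;
  fib : B -> lmodType R;
  incl : forall b, fib b -> E;
  _ : smooth proj;
  _ : forall b, injective (@incl b);
  _ : forall b e, proj e = b <-> exists v : fib b, incl v = e;
  _ : forall b0, exists (U : set B) (phi : E -> euclid R rank)
        (psi : prodc B (euclid R rank) -> E),
      [/\ open U /\ U b0,
          forall e, U (proj e) -> smooth_at phi e,
          forall b c, U b ->
            [/\ smooth_at psi (b, c), proj (psi (b, c)) = b
              & phi (psi (b, c)) = c],
          forall e, U (proj e) -> psi (proj e, phi e) = e
        & forall b, U b ->
            linear (fun v : fib b => phi (incl v) : 'rV[R]_rank)] }.

Section VBMaps.
Context {R : realType}.

(* The (non-smooth part of the) condition that [F] be a vector bundle morphism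
   covering [f]. *)
Definition fibrewise_linear (E B E' B' : manifold R)
    (V : vbundle E B) (V' : vbundle E' B') (F : E -> E') (f : B -> B') : Prop :=
  forall x, exists Fx : {linear fib V x -> fib V' (f x)},
    forall v, F (incl v) = incl (Fx v).

(* The inverse of the restriction of [F] to the fibre over [x], meaningful when
   [F] is a fibrewise isomorphism covering [f]. *)
Definition fib_inv (E B E' B' : manifold R)
    (V : vbundle E B) (V' : vbundle E' B') (F : E -> E') (f : B -> B')
    (x : B) (w : fib V' (f x)) : fib V x :=
  xget 0 [set v : fib V x | F (incl v) = incl w].

Definition preform (E B : manifold R) (V : vbundle E B) : Type :=
  forall x : B, 'rV[R]_(cdim B) -> fib V x.

(* Smoothness of a [V]-valued 1-form: its values on coordinate vector fields
   are smooth local sections of [V]. *)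
Definition is_form (E B : manifold R) (V : vbundle E B)
    (theta : preform V) : Prop :=
  (forall x, linear (theta x)) /\
  forall (x0 : B) v,
    smooth_at (fun x : B => incl (theta x (coord_field x0 v x)) : E) x0.

Definition pullback (E B E' B' : manifold R)
    (V : vbundle E B) (V' : vbundle E' B') (F : E -> E') (f : B -> B')
    (theta : preform V') : preform V :=
  fun x v => fib_inv V F (theta (f x) (tmap f x v)).

End VBMaps.

(** * Lie groupoids *)

(* [mul g h] is meaningful when [src g = tgt h]. *)
Record lieGroupoid (R : realType) := LieGroupoid {
  arr : manifold R;
  obj : manifold R;
  src : arr -> obj;
  tgt : arr -> obj;
  unt : obj -> arr;
  inv : arr -> arr;
  mul : arr -> arr -> arr;
  _ : submersion src;
  _ : submersion tgt;
  _ : smooth unt;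
  _ : smooth inv;
  _ : smooth_on (X := prodc arr arr) [set w | src w.1 = tgt w.2]
        (fun w => mul w.1 w.2);
  _ : forall x, src (unt x) = x /\ tgt (unt x) = x;
  _ : forall g h, src g = tgt h ->
        src (mul g h) = src h /\ tgt (mul g h) = tgt g;
  _ : forall g h k, src g = tgt h -> src h = tgt k ->
        mul g (mul h k) = mul (mul g h) k;
  _ : forall g, mul (unt (tgt g)) g = g /\ mul g (unt (src g)) = g;
  _ : forall g, src (inv g) = tgt g /\ tgt (inv g) = src g;
  _ : forall g, mul g (inv g) = unt (tgt g) /\ mul (inv g) g = unt (src g) }.

Record lgMorphism (R : realType) (H G : lieGroupoid R) := LgMorphism {
  on_arr : arr H -> arr G;
  on_obj : obj H -> obj G;
  _ : smooth on_arr;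
  _ : smooth on_obj;
  _ : forall h, src (on_arr h) = on_obj (src h);
  _ : forall h, tgt (on_arr h) = on_obj (tgt h);
  _ : forall y, on_arr (unt y) = unt (on_obj y);
  _ : forall h h', src h = tgt h' ->
        on_arr (mul h h') = mul (on_arr h) (on_arr h') }.

Section Groupoids.
Context {R : realType}.

Definition is_morita (H G : lieGroupoid R) (f : lgMorphism H G) : Prop :=
  is_fibre_product (Y := prodc (obj H) (obj H))
    (on_arr f) (fun h => (src h, tgt h))
    (fun g : arr G => (src g, tgt g))
    (fun y => (on_obj f y.1, on_obj f y.2)) /\
  exists (P : manifold R) (p : P -> arr G) (q : P -> obj H),
    [/\ is_fibre_product p q (@src R G) (on_obj f),
        forall x : obj G, exists z, tgt (p z) = x
      & submersion (fun z => tgt (p z))].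

(* The fibre at [x] of the Lie algebroid, a subspace of the tangent space of
   [arr G] at the unit of [x]. *)
Definition algebroid (G : lieGroupoid R) (x : obj G) :
    {vspace 'rV[R]_(cdim (arr G))} :=
  lker (linfun (tmap (@src R G) (unt x))).

Definition anchor (G : lieGroupoid R) (x : obj G)
    (a : subvs_of (algebroid x)) : 'rV[R]_(cdim (obj G)) :=
  tmap (@tgt R G) (unt x) (vsval a).

End Groupoids.

(** * VB-groupoids *)

Record vbGroupoid (R : realType) := VbGroupoid {
  total : lieGroupoid R;
  base : lieGroupoid R;
  vb_arr : vbundle (arr total) (arr base);
  vb_obj : vbundle (obj total) (obj base);
  _ : fibrewise_linear vb_arr vb_obj (@src R total) (@src R base);
  _ : fibrewise_linear vb_arr vb_obj (@tgt R total) (@tgt R base);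
  _ : fibrewise_linear vb_obj vb_arr (@unt R total) (@unt R base);
  _ : fibrewise_linear vb_arr vb_arr (@inv R total) (@inv R base);
  (* the multiplication is linear on the fibre of composable pairs in [total]
     over each composable pair [(g, h)] in [base] *)
  _ : forall g h : arr base, src g = tgt h ->
      forall (a : R) (v v' : fib vb_arr g) (w w' : fib vb_arr h),
      src (incl v) = tgt (incl w) -> src (incl v') = tgt (incl w') ->
      exists z z' : fib vb_arr (mul g h),
        [/\ mul (incl v) (incl w) = incl z,
            mul (incl v') (incl w') = incl z'
          & mul (incl (a *: v + v')) (incl (a *: w + w')) =
              incl (a *: z + z')] }.

Record vbgMorphism (R : realType) (W V : vbGroupoid R) := VbgMorphism {
  mor_total : lgMorphism (total W) (total V);
  mor_base : lgMorphism (base W) (base V);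
  _ : fibrewise_linear (vb_arr W) (vb_arr V) (on_arr mor_total)
        (on_arr mor_base);
  _ : fibrewise_linear (vb_obj W) (vb_obj V) (on_obj mor_total)
        (on_obj mor_base) }.

Section LineBundleGroupoids.
Context {R : realType}.

Definition is_vb_morita (W V : vbGroupoid R) (F : vbgMorphism W V) : Prop :=
  is_morita (mor_total F).

Definition is_lbg (L : vbGroupoid R) : Prop :=
  rank (vb_arr L) = 1%N /\ rank (vb_obj L) = 1%N.

Definition coboundary (L : vbGroupoid R) (theta : preform (vb_obj L)) :
    preform (vb_arr L) :=
  fun g v =>
    pullback (vb_arr L) (@src R (total L)) (@src R (base L)) theta g v -
    pullback (vb_arr L) (@tgt R (total L)) (@tgt R (base L)) theta g v.

Definition pullback_obj (L' L : vbGroupoid R) (F : vbgMorphism L' L)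
    (theta : preform (vb_obj L)) : preform (vb_obj L') :=
  pullback (vb_obj L') (on_obj (mor_total F)) (on_obj (mor_base F)) theta.

End LineBundleGroupoids.

(** * Three-term complexes and quasi-isomorphisms *)

Section Cohomology.
Context {R : realType}.

(* The cohomology of [A -d-> B -d'-> C] at [B], as the set of cosets modulo the
   image of [d] of the elements of the kernel of [d']. *)
Definition coh_class (A B : lmodType R) (d : A -> B) (b : B) : set B :=
  [set b + d a | a in setT].

Definition cohomology (A B C : lmodType R) (d : A -> B) (d' : B -> C) :
    set (set B) :=
  [set coh_class d b | b in [set b | d' b = 0]].

Definition coh_map (B A' B' : lmodType R) (e : A' -> B') (f : B -> B')
    (S : set B) : set B' :=
  \bigcup_(b in S) coh_class e (f b).

(* The data of [0 -> cm1 -> c0 -> c1 -> 0], in degrees -1, 0, 1. *)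
Record triple := Triple {
  cm1 : lmodType R;
  c0 : lmodType R;
  c1 : lmodType R;
  dm1 : cm1 -> c0;
  d0 : c0 -> c1 }.

Definition is_complex (C : triple) : Prop :=
  [/\ linear (@dm1 C), linear (@d0 C) & forall a : cm1 C, d0 (dm1 a) = 0].

Definition is_cochain_map (C D : triple)
    (fm1 : cm1 C -> cm1 D) (f0 : c0 C -> c0 D) (f1 : c1 C -> c1 D) : Prop :=
  [/\ linear fm1, linear f0, linear f1,
      forall a, f0 (dm1 a) = dm1 (fm1 a)
    & forall b, f1 (d0 b) = d0 (f0 b)].

Definition from0 (B : lmodType R) : 'rV[R]_0 -> B := fun=> 0.
Definition to0 (B : lmodType R) : B -> 'rV[R]_0 := fun=> 0.

Definition is_quasi_iso (C D : triple)
    (fm1 : cm1 C -> cm1 D) (f0 : c0 C -> c0 D) (f1 : c1 C -> c1 D) : Prop :=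
  [/\ is_complex C /\ is_complex D,
      is_cochain_map fm1 f0 f1,
      set_bij (cohomology (@from0 (cm1 C)) (@dm1 C))
        (cohomology (@from0 (cm1 D)) (@dm1 D))
        (coh_map (@from0 (cm1 D)) fm1),
      set_bij (cohomology (@dm1 C) (@d0 C)) (cohomology (@dm1 D) (@d0 D))
        (coh_map (@dm1 D) f0)
    & set_bij (cohomology (@d0 C) (@to0 (c1 C)))
        (cohomology (@d0 D) (@to0 (c1 D)))
        (coh_map (@d0 D) f1)].

Definition morita_kernel (L : vbGroupoid R) (theta : preform (vb_obj L))
    (x : obj (base L)) : triple :=
  @Triple (subvs_of (algebroid x)) 'rV[R]_(cdim (obj (base L)))
    (fib (vb_obj L) x) (@anchor R (base L) x) (theta x).

End Cohomology.

(* Main.v *)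
From HB Require Import structures.
Require Import Defs.
From mathcomp Require Import ring lra interval_inference landau sequences.
Import Order.TTheory GRing.Theory Num.Theory numFieldNormedType.Exports.
Local Open Scope classical_set_scope.
Local Open Scope ring_scope.

(** Write x = f y.  Four facts tie the two Morita kernels together:
    - the square formed by the two anchors and by df : A_{H,y} -> A_{G,x},
      df : T_yN -> T_xM is cartesian ([base_arrow_tangent_inj] and
      [base_arrow_tangent_surj]);
    - T_xM is the sum of df (T_yN) and of the image of the anchor of G
      ([base_tangent_split]), so that the square is cocartesian as well;
    - theta vanishes on the image of the anchor, as one sees by evaluating
      s^*theta = t^*theta on vectors tangent to a source fibre at a unit
      ([closed_anchor]);
    - F restricts to an isomorphism between the fibres over y and x
      ([morita_fibre_inj] together with [line_map_surj]).
    A bicartesian square and an isomorphism in degree 1 make the mapping cone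
    exact, which is [quasi_iso_criterion].

    The Morita hypotheses concern the total groupoids.  They descend to the
    bases along the zero sections, which are groupoid morphisms preserved by F
    with the bundle projections as left inverses.  In this way a local inverse
    of the embedding of the arrows of L' into a fibre product yields one for
    the arrows of H ([base_retraction]), and the submersion property yields,
    for each u in T_xM, a vector a at the unit of x with dt a = u and
    ds a in df (T_yN) ([base_submersion]).

    That the arrows of H form a fibre product as a manifold gives the cartesian
    square only because the fibre product is transverse: otherwise a vector
    satisfying the linearised equations need not be tangent to a solution.
    Transversality comes from [base_submersion] for the targets and, after
    inverting arrows, for the sources ([base_transverse]).  The analytic input
    is a weak form of the implicit function theorem: if dF_p is onto and
    dF_p w = 0, then F takes the value F p at points p + t w + o(t)
    ([level_set_approx]).  Hence every strictly differentiable map that is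
    constant on the level set of F has w in the kernel of its differential
    ([level_set_kernel]).  Applied to the difference between the identity and
    the retraction onto the fibre product, this shows that each solution of the
    linearised equations is fixed by the differential of the retraction, thus
    tangent to the fibre product ([fibre_product_tangent]). *)

Set Implicit Arguments.
Unset Strict Implicit.
Unset Printing Implicit Defensive.

(** Coordinate spaces are complete, as fixed points of contractions require. *)
HB.instance Definition _ (R : realType) m n := Complete.on 'M[R]_(m, n).

(** * Strict derivatives in coordinate spaces *)

Section StrictDerivatives.
Context {R : realType}.

Lemma normr_mxP m n (x : 'M[R]_(m, n)) (c : R) :
  0 <= c -> (`|x| <= c <-> forall i j, `|x i j| <= c).
Proof.
move=> c0; rewrite /Num.norm /= mx_normrE; split=> [/bigmax_leP[_ xc] i j|xc].
  exact: (xc (i, j)).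
by apply/bigmax_leP; split=> // -[i j] _; apply: xc.
Qed.

Lemma normr_entry m n (x : 'M[R]_(m, n)) i j : `|x i j| <= `|x|.
Proof. by have /normr_mxP := lexx `|x|; apply. Qed.

Lemma mulmx_bounded m n (M : 'M[R]_(m, n)) :
  exists2 K : R, 0 < K & forall v : 'rV_m, `|v *m M| <= K * `|v|.
Proof.
exists (1 + `|M| *+ m) => [|v]; first by rewrite ltr_pwDl// mulrn_wge0.
apply/normr_mxP => [|i j]; first by rewrite mulr_ge0// addr_ge0// mulrn_wge0.
rewrite mxE (le_trans (ler_norm_sum _ _ _))//.
apply: (@le_trans _ _ (\sum_(k < m) `|M| * `|v|)).
  by apply: ler_sum => k _; rewrite normrM mulrC ler_pM// normr_entry.
rewrite sumr_const card_ord mulrDl mul1r -mulrnAl lerDr.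
exact: normr_ge0.
Qed.

(** The strict Frechet derivative: since both points vary, F differs from its
    linearisation by a map with small Lipschitz constant near p, which makes
    Newton iterations contract.  Vectors are rows, so M acts on the right. *)
Definition strict_diff m n (F : 'rV[R]_m -> 'rV[R]_n) (M : 'M[R]_(m, n))
    (p : 'rV[R]_m) : Prop :=
  forall e : R, 0 < e -> \forall q \near (p, p),
    `|F q.1 - F q.2 - (q.1 - q.2) *m M| <= e * `|q.1 - q.2|.

Lemma near_diag (T : topologicalType) (p : T) (P : set T) :
  (\forall x \near p, P x) -> \forall q \near (p, p), P q.1 /\ P q.2.
Proof. by move=> Pp; exists (P, P). Qed.

Lemma near_diag_left (T : topologicalType) (p : T) (P : set (T * T)) :
  (\forall q \near (p, p), P q) -> \forall x \near p, P (x, p).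
Proof.
move=> [[A B] /= [Ap Bp] AB]; apply: filterS Ap => x Ax; apply: AB.
by split=> //=; apply: nbhs_singleton.
Qed.

Lemma strict_diff_ball m n (F : 'rV_m -> 'rV_n) M p (e : R) :
  strict_diff F M p -> 0 < e ->
  exists2 d : R, 0 < d & forall a b, `|p - a| < d -> `|p - b| < d ->
    `|F a - F b - (a - b) *m M| <= e * `|a - b|.
Proof.
move=> FM e0; have [[A B] /= [/nbhs_normP[d1 d10 d1A] /nbhs_normP[d2 d20 d2B]]]
  := FM _ e0.
move=> AB; exists (Num.min d1 d2); first by rewrite lt_min d10.
move=> a b; rewrite !lt_min => /andP[ad1 _] /andP[_ bd2].
by apply: (AB (a, b)); split; [apply: d1A|apply: d2B].
Qed.

Lemma strict_diff_differential m n (F : 'rV[R]_m -> 'rV[R]_n) M p :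
  strict_diff F M p -> differentiable F p /\ forall v, 'd F p v = v *m M.
Proof.
move=> FM.
have Mc : continuous (mulmxr M : 'rV_m -> 'rV_n).
  apply/linear_bounded_continuous/linear_boundedP.
  have [K K0 MK] := mulmx_bounded M.
  have : \forall r \near +oo, K <= r by apply: nbhs_pinfty_ge; rewrite num_real.
  by apply: filterS => r Kr v; rewrite /= (le_trans (MK v))// ler_wpM2r.
have FM' : F \o shift p = cst (F p) + mulmxr M +o_ 0 id.
  apply/eqaddoP => e e0; near=> h.
  have -> : (F \o shift p - (cst (F p) + mulmxr M)) h =
            F (h + p) - F p - h *m M by rewrite !fctE /= opprD addrA.
  have : `|F (h + p, p).1 - F (h + p, p).2 - ((h + p, p).1 - (h + p, p).2) *m M|
         <= e * `|(h + p, p).1 - (h + p, p).2|.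
    near: h.
    have := near_diag_left (FM _ e0); rewrite (near_shift 0).
    by apply: filterS => h /=; rewrite subr0.
  by rewrite /= addrK.
have dF := diff_unique (df := mulmxr M) Mc FM'; split; last by move=> v;
  rewrite dF.
by apply/diff_locallyP; rewrite dF.
Unshelve. all: by end_near. Qed.

Lemma strict_diff_continuous m n (F : 'rV[R]_m -> 'rV[R]_n) M p :
  strict_diff F M p -> {for p, continuous F}.
Proof.
by move=> /strict_diff_differential[dF _]; exact: differentiable_continuous.
Qed.

Lemma strict_diff_near m n (F G : 'rV[R]_m -> 'rV[R]_n) M p :
  (\forall x \near p, F x = G x) -> strict_diff F M p -> strict_diff G M p.
Proof.
move=> FG FM e e0; near=> q.
have [<- <-] : F q.1 = G q.1 /\ F q.2 = G q.2 by near: q; exact: (near_diag FG).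
by near: q; exact: FM.
Unshelve. all: by end_near. Qed.

Lemma strict_diff_mulmx m n (M : 'M[R]_(m, n)) p :
  strict_diff (fun v => v *m M) M p.
Proof.
move=> e e0; near=> q; rewrite mulmxBl subrr normr0.
by rewrite mulr_ge0// ltW.
Unshelve. all: by end_near. Qed.

Lemma strict_diff_id m (p : 'rV[R]_m) : strict_diff id 1%:M p.
Proof.
apply: strict_diff_near (strict_diff_mulmx _ _).
by near=> x; rewrite mulmx1.
Unshelve. all: by end_near. Qed.

Lemma strict_diffB m n (F G : 'rV[R]_m -> 'rV[R]_n) M N p :
  strict_diff F M p -> strict_diff G N p ->
  strict_diff (fun x => F x - G x) (M - N) p.
Proof.
move=> FM GN e e0; have e20 : 0 < e / 2 by rewrite divr_gt0.
near=> q.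
have Fq : `|F q.1 - F q.2 - (q.1 - q.2) *m M| <= e / 2 * `|q.1 - q.2|.
  by near: q; exact: FM.
have Gq : `|G q.1 - G q.2 - (q.1 - q.2) *m N| <= e / 2 * `|q.1 - q.2|.
  by near: q; exact: GN.
have -> : F q.1 - G q.1 - (F q.2 - G q.2) - (q.1 - q.2) *m (M - N) =
  (F q.1 - F q.2 - (q.1 - q.2) *m M) - (G q.1 - G q.2 - (q.1 - q.2) *m N).
  rewrite mulmxBr; move: (_ *m M) (_ *m N) => u v.
  by apply/matrixP => i j; rewrite !mxE; ring.
by rewrite (le_trans (ler_normB _ _))// [e in leRHS]splitr mulrDl lerD.
Unshelve. all: by end_near. Qed.

Lemma strict_diff_row_mx m n1 n2 (F : 'rV[R]_m -> 'rV[R]_n1)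
    (G : 'rV[R]_m -> 'rV[R]_n2) M N p :
  strict_diff F M p -> strict_diff G N p ->
  strict_diff (fun x => row_mx (F x) (G x)) (row_mx M N) p.
Proof.
move=> FM GN e e0; near=> q.
have Fq : `|F q.1 - F q.2 - (q.1 - q.2) *m M| <= e * `|q.1 - q.2|.
  by near: q; exact: FM.
have Gq : `|G q.1 - G q.2 - (q.1 - q.2) *m N| <= e * `|q.1 - q.2|.
  by near: q; exact: GN.
rewrite mul_mx_row !(opp_row_mx, add_row_mx); apply/normr_mxP => [|i j].
  by rewrite mulr_ge0// ltW.
rewrite mxE; case: splitP => k _; first exact: le_trans (normr_entry _ _ _) Fq.
exact: le_trans (normr_entry _ _ _) Gq.
Unshelve. all: by end_near. Qed.

Lemma strict_diff_comp m n k (F : 'rV[R]_m -> 'rV[R]_n)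
    (G : 'rV[R]_n -> 'rV[R]_k) M N p :
  strict_diff F M p -> strict_diff G N (F p) ->
  strict_diff (G \o F) (M *m N) p.
Proof.
move=> FM GN e e0.
have [K K0 MK] := mulmx_bounded M; have [L L0 NL] := mulmx_bounded N.
have e1 : 0 < e / (2 * L) by rewrite divr_gt0// mulr_gt0.
have e2 : 0 < e / (2 * (K + 1)) by rewrite divr_gt0// mulr_gt0// addr_gt0.
have GFN : \forall q \near (p, p),
    `|G (F q.1) - G (F q.2) - (F q.1 - F q.2) *m N| <=
    e / (2 * (K + 1)) * `|F q.1 - F q.2|.
  have [[A B] /= [FpA FpB] AB] := GN _ e2.
  have Fc := strict_diff_continuous FM.
  exists (F @^-1` A, F @^-1` B); first by split; apply: Fc.
  by move=> q [qA qB]; apply: (AB (F q.1, F q.2)).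
near=> q => /=.
have Gq : `|G (F q.1) - G (F q.2) - (F q.1 - F q.2) *m N| <=
    e / (2 * (K + 1)) * `|F q.1 - F q.2|.
  by near: q; exact: GFN.
have Fq : `|F q.1 - F q.2 - (q.1 - q.2) *m M| <= e / (2 * L) * `|q.1 - q.2|.
  by near: q; exact: (FM _ e1).
have Fq1 : `|F q.1 - F q.2 - (q.1 - q.2) *m M| <= 1 * `|q.1 - q.2|.
  by near: q; exact: (FM _ ltr01).
have Fq2 : `|F q.1 - F q.2| <= (K + 1) * `|q.1 - q.2|.
  rewrite -[F q.1 - F q.2](subrK ((q.1 - q.2) *m M)) (le_trans (ler_normD _ _))//.
  by rewrite addrC mulrDl lerD.
have -> : G (F q.1) - G (F q.2) - (q.1 - q.2) *m (M *m N) =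
   (G (F q.1) - G (F q.2) - (F q.1 - F q.2) *m N) +
   (F q.1 - F q.2 - (q.1 - q.2) *m M) *m N.
  by rewrite [X in _ = _ + X]mulmxBl mulmxA addrA subrK.
rewrite (le_trans (ler_normD _ _))// [e in leRHS]splitr mulrDl lerD//.
  apply: le_trans Gq _; apply: le_trans (ler_wpM2l (ltW e2) Fq2) _.
  by rewrite mulrA le_eqVlt; apply/orP; left; apply/eqP; field; lra.
apply: le_trans (NL _) _; apply: le_trans (ler_wpM2l (ltW L0) Fq) _.
by rewrite mulrA le_eqVlt; apply/orP; left; apply/eqP; field; lra.
Unshelve. all: by end_near. Qed.



(** The mean value theorem, applied on a segment to each coordinate of f, bounds
    f a - f b - df_p (a - b) by the variation of df near p, which is small
    because the partial derivatives are continuous. *)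
Lemma Cinfty_strict_diff m n (U : set 'rV[R]_m) (f : 'rV[R]_m -> 'rV[R]_n) p :
  open U -> U p -> Cinfty U f -> exists M, strict_diff f M p.
Proof.
move=> oU Up /(_ 1%N)[df cdf]; exists (lin1_mx ('d f p)) => e e0.
have e'0 : 0 < e / m.+1%:R by rewrite divr_gt0.
have /nbhs_normP[d /= d0 dU] : \forall x \near p, U x /\ forall i : 'I_m,
    `|'D_(delta_mx 0 i) f x - 'D_(delta_mx 0 i) f p| <= e / m.+1%:R.
  have nU : \forall x \near p, U x := open_nbhs_nbhs (conj oU Up).
  have nD i : \forall x \near p,
      `|'D_(delta_mx 0 i) f x - 'D_(delta_mx 0 i) f p| <= e / m.+1%:R.
    near=> x; rewrite distrC; near: x.
    by have /cvgrPdist_le/(_ _ e'0) := cdf (delta_mx 0 i) p Up.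
  near=> x; split; first by near: x.
  by near: x; exact: (filter_forall _ nD).
have dE x h : U x ->
    'd f x h = \sum_(i < m) h 0 i *: 'D_(delta_mx 0 i) f x.
  move=> Ux; rewrite {1}(row_sum_delta h) linear_sum; apply: eq_bigr => i _.
  by rewrite linearZ deriveE//; exact: df.
have dist x h : ball_ Num.norm p d x ->
    `|'d f x h - 'd f p h| <= e * `|h|.
  move=> /dU[Ux xe].
  have -> : 'd f x h - 'd f p h = \sum_(i < m)
      h 0 i *: ('D_(delta_mx 0 i) f x - 'D_(delta_mx 0 i) f p).
    under eq_bigr do rewrite scalerBr.
    by rewrite sumrB; congr (_ - _); exact: dE.
  apply: (le_trans (ler_norm_sum _ _ _)).
  apply: (@le_trans _ _ (\sum_(i < m) (`|h| * (e / m.+1%:R)))).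
    apply: ler_sum => i _; rewrite normrZ ler_pM//.
    exact: normr_entry.
  rewrite sumr_const card_ord -mulrnAr mulrC ler_wpM2r// -mulr_natr.
  by rewrite mulrAC ler_pdivrMr// ler_pM2l// ler_nat.
have : \forall q \near (p, p), ball_ Num.norm p d q.1 /\ ball_ Num.norm p d q.2.
  by apply: near_diag; apply/nbhs_normP; exists d.
apply: filterS => -[a b] /= [ad bd].
set h := a - b.
have seg (t : R) : t \in `[0, 1] -> ball_ Num.norm p d (b + t *: h).
  rewrite in_itv/= => /andP[t0 t1] /=.
  have -> : p - (b + t *: h) = (1 - t) *: (p - b) + t *: (p - a).
    by apply/matrixP => i j; rewrite !mxE; ring.
  rewrite (le_lt_trans (ler_normD _ _))// !normrZ !ger0_norm ?subr_ge0//.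
  have [->|t00] := eqVneq t 0; first by rewrite mul0r addr0 subr0 mul1r.
  rewrite [d in ltRHS](_ : d = (1 - t) * d + t * d); last by ring.
  apply: ler_ltD; first by rewrite ler_wpM2l ?subr_ge0// ltW.
  by rewrite ltr_pM2l// lt0r t00.
apply/normr_mxP => [|i j]; first by rewrite mulr_ge0// ltW.
rewrite mul_rV_lin1.
have der (t : R) : t \in `[0, 1] ->
    is_derive t 1 (fun t : R => f (b + t *: h) i j) ('d f (b + t *: h) h i j).
  move=> /seg/dU[Ut _].
  have E : (fun k : R => k^-1 *: (((fun t : R => f (b + t *: h)) \o shift t)
        (k *: 1) - f (b + t *: h))) =
      (fun k => k^-1 *: ((f \o shift (b + t *: h)) (k *: h) - f (b + t *: h))).
    apply/funext => k /=; do 3 congr (_ _).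
    by rewrite [k *: 1]mulr1 scalerDl addrCA.
  have dft : derivable (fun t : R => f (b + t *: h)) t 1.
    by rewrite /derivable E; apply: diff_derivable; exact: df.
  have Dft : 'D_1 (fun t : R => f (b + t *: h)) t = 'd f (b + t *: h) h.
    by rewrite /derive E -deriveE//; exact: df.
  split; first by have /derivable_mxP := dft; apply.
  by have := derive_mx dft; rewrite Dft => ->; rewrite mxE.
have [c c01 fc] := MVT_segment ler01
   (fun t t01 => der t (subset_itv_oo_cc t01))
   (derivable_within_continuous (fun t t01 =>
     @ex_derive _ _ _ _ _ _ _ (der t t01))).
have -> : (f a - f b - 'd f p h) i j = ('d f (b + c *: h) h - 'd f p h) i j.
  move: fc; rewrite scale1r scale0r addr0 subr0 mulr1 [b + h]addrC subrK.
  by rewrite !mxE => ->.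
exact: le_trans (normr_entry _ _ _) (dist _ h (seg _ c01)).
Unshelve. all: by end_near. Qed.

(** Half of the implicit function theorem.  With B a right inverse of M, the
    value of F at p + t w is off by o(t), and the correction u B that repairs
    it is given by a fixed point of u |-> u - (F (p + t w + u B) - F p), a
    contraction by one half of a ball whose radius is proportional to t. *)
Lemma level_set_approx m n (F : 'rV[R]_m -> 'rV[R]_n) M p (w : 'rV_m) (e : R) :
  strict_diff F M p -> row_full M -> w *m M = 0 -> 0 < e ->
  exists2 t0 : R, 0 < t0 & forall t, 0 < t -> t < t0 ->
    exists2 h, `|h| <= e * t & F (p + (t *: w + h)) = F p.
Proof.
move=> FM fullM wM e0.
have BM := mulVpmx fullM; set B := pinvmx M in BM.
have [K K0 BK] := mulmx_bounded B.
have [W W0 wW] : exists2 W : R, 0 < W & `|w| <= W.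
  by exists (`|w| + 1); rewrite ?ltr_wpDl// lerDl.
(* The first bound gives the contraction factor, the second keeps the
   correction below e t. *)
pose c := Num.min (2 * K)^-1 (e / (2 * W * K)).
have c0 : 0 < c.
  rewrite lt_min; apply/andP; split; first by rewrite invr_gt0 mulr_gt0.
  by rewrite divr_gt0// !mulr_gt0.
have cK : c * K <= 2^-1.
  by rewrite -ler_pdivlMr// -invfM ge_min lexx.
have cWK : 2 * c * W * K <= e.
  have : c <= e / (2 * W * K) by rewrite ge_min lexx orbT.
  by rewrite ler_pdivlMr ?mulr_gt0//; apply: le_trans; rewrite le_eqVlt;
     apply/orP; left; apply/eqP; ring.
have [d d0 dF] := strict_diff_ball FM c0.
exists (d / (W + e)) => [|t t0]; first by rewrite divr_gt0// addr_gt0.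
rewrite ltr_pdivlMr ?addr_gt0// => td.
pose r := 2 * c * W * t; have r0 : 0 < r by rewrite !mulr_gt0.
pose U := [set u : 'rV[R]_n | `|u| <= r].
have UB u : U u -> `|u *m B| <= e * t.
  move=> Uu; apply: le_trans (BK u) _; rewrite mulrC.
  apply: le_trans (ler_wpM2r (ltW K0) Uu) _.
  by rewrite /r mulrAC ler_wpM2r// ltW.
pose x u := p + (t *: w + u *m B).
have xd u : U u -> `|p - x u| < d.
  move=> /UB uB; rewrite /x opprD addNKr normrN.
  apply: le_lt_trans td; rewrite (le_trans (ler_normD _ _))// mulrDr lerD//.
    by rewrite normrZ gtr0_norm// (ler_wpM2l (ltW t0)).
  by rewrite mulrC.
pose T u := u - (F (x u) - F p).
have TT u v : U u -> U v -> `|T u - T v| <= 2^-1 * `|u - v|.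
  move=> Uu Uv; have := dF _ _ (xd _ Uu) (xd _ Uv).
  have xB : x u - x v = (u - v) *m B.
    by rewrite mulmxBl /x; apply/matrixP => i j; rewrite !mxE; ring.
  rewrite xB -mulmxA BM mulmx1 => FB.
  have -> : T u - T v = - (F (x u) - F (x v) - (u - v)).
    by rewrite /T; apply/matrixP => i j; rewrite !mxE; ring.
  rewrite normrN; apply: le_trans FB _.
  apply: le_trans (ler_wpM2l (ltW c0) (BK _)) _.
  by rewrite mulrA ler_wpM2r.
have U0 : U 0 by rewrite /U/= normr0 ltW.
have T0 : `|T 0| <= r / 2.
  have := dF _ _ (xd _ U0) (_ : `|p - p| < d); rewrite subrr normr0 => /(_ d0).
  have -> : x 0 - p = t *: w by rewrite /x mul0mx addr0 [LHS]addrC addKr.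
  rewrite -scalemxAl wM scaler0 subr0 /T sub0r normrN => /le_trans; apply.
  rewrite normrZ gtr0_norm// /r.
  rewrite [leRHS](_ : _ = c * (t * W)); last by field.
  by rewrite (ler_wpM2l (ltW c0))// (ler_wpM2l (ltW t0)).
have TU : {homo T : u / U u >-> U u}.
  move=> u Uu; rewrite /U/= -[T u](subrK (T 0)) (le_trans (ler_normD _ _))//.
  rewrite [r]splitr lerD//; apply: le_trans (TT _ _ Uu U0) _.
  by rewrite subr0 mulrC ler_wpM2r.
have contrT : is_contraction (mkfun TU : {fun U >-> U}).
  exists (2^-1)%:nng; split; first by rewrite /=; lra.
  by move=> -[u v] [/= Uu Uv]; exact: TT.
have clU : closed U.
  rewrite (_ : U = (fun u => `|u|) @^-1` [set y | y <= r])//.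
  by apply: preimage_closed => [u _|]; [exact: norm_continuous|exact: closed_le].
have [u Uu /= uT] := banach_fixed_point contrT clU (ex_intro _ 0 U0).
exists (u *m B); first exact: UB.
move: uT; rewrite /mkfun /T -[X in X = _]subr0 => /addrI/oppr_inj/esym/eqP.
by rewrite subr_eq0 => /eqP.
Qed.

(** The vector w is a limit of directions of secants of the level set of F
    through p, and G is constant along them. *)
Lemma level_set_kernel m n k (F : 'rV[R]_m -> 'rV[R]_n)
    (G : 'rV[R]_m -> 'rV[R]_k) M N p (w : 'rV_m) :
  strict_diff F M p -> row_full M -> strict_diff G N p ->
  (\forall x \near p, F x = F p -> G x = G p) ->
  w *m M = 0 -> w *m N = 0.
Proof.
move=> FM fullM GN /nbhs_normP[d /= d0 dFG] wM.
have [K K0 NK] := mulmx_bounded N.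
(* With q = t w + h a secant, t (w N) = q N - h N, where q N is small because
   G (p + q) = G p and h N because h is small compared with t. *)
pose C := `|w| + 1 + K; have C0 : 0 < C by rewrite addr_gt0// ltr_wpDl.
suff small e : 0 < e -> e <= 1 -> `|w *m N| <= C * e.
  apply/eqP; rewrite -normr_le0; apply/ler_addgt0Pr => e e0; rewrite add0r.
  pose e' := Num.min 1 (e / C).
  apply: (@le_trans _ _ (C * e')).
    by apply: small; rewrite /e' ?lt_min ?ltr01 ?divr_gt0// ge_min lexx.
  by rewrite mulrC -ler_pdivlMr// ge_min lexx orbT.
move=> e0 e1; have [t0 t00 t0F] := level_set_approx FM fullM wM e0.
have [d' d'0 d'G] := strict_diff_ball GN e0.
pose D := Num.min d d'; have D0 : 0 < D by rewrite lt_min d0.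
pose t := Num.min (t0 / 2) (D / 2 / C).
have t_gt0 : 0 < t by rewrite lt_min !divr_gt0.
have tt0 : t < t0 by rewrite (@le_lt_trans _ _ (t0 / 2)) ?ge_min ?lexx//; lra.
have tCD : t * C < D.
  rewrite (@le_lt_trans _ _ (D / 2))//; last by lra.
  by rewrite -ler_pdivlMr// ge_min lexx orbT.
have [h he Fh] := t0F t t_gt0 tt0.
set q := t *: w + h.
have qt : `|q| <= t * (`|w| + 1).
  rewrite (le_trans (ler_normD _ _))// normrZ gtr0_norm// mulrDr lerD// mulr1.
  by rewrite (le_trans he)// ler_piMl// ltW.
have qD : `|p - (p + q)| < D.
  rewrite opprD addNKr normrN (le_lt_trans qt)// (le_lt_trans _ tCD)//.
  by rewrite (ler_wpM2l (ltW t_gt0))// lerDl ltW.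
have Gq : G (p + q) = G p.
  by apply: dFG => //; apply: lt_le_trans qD _; rewrite ge_min lexx.
have := d'G (p + q) p; rewrite subrr normr0 Gq subrr sub0r normrN [p + q]addrC
  addrK.
move=> /(_ _ d'0) qN.
have {}qN : `|q *m N| <= e * `|q|.
  apply: qN; rewrite [q + p]addrC; apply: lt_le_trans qD _.
  by rewrite ge_min lexx orbT.
have wE : t *: (w *m N) = q *m N - h *m N.
  by rewrite /q mulmxDl addrK scalemxAl.
rewrite -(ler_pM2l t_gt0) -[t in leLHS]gtr0_norm// -normrZ wE.
rewrite (le_trans (ler_normB _ _))//.
rewrite [leRHS](_ : _ = e * (t * (`|w| + 1)) + K * (e * t)); last
  by rewrite /C; ring.
rewrite lerD//; first by rewrite (le_trans qN)// ler_wpM2l// ltW.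
by rewrite (le_trans (NK _))// ler_wpM2l// ltW.
Qed.

End StrictDerivatives.

(** * Charts and tangent maps *)

Section Charts.
Context {R : realType}.

(** The axioms of an atlas that involve only the preferred chart at x, and only
    near x.  Unlike the structure of a manifold they make sense for, and pass
    to, products of charted spaces. *)
Definition regular_at (X : charted R) (x : X) : Prop :=
  [/\ \forall y \near x, chart_inv x (chart x y) = y,
      \forall v \near chart x x, chart x (chart_inv x v) = v,
      {for x, continuous (chart x)}
    & {for chart x x, continuous (chart_inv x)}].

Lemma manifold_regular (X : manifold R) (x : X) : regular_at x.
Proof.
case: X x => X hX sX oX oimX cinvX cX cIX eX x /=.
have [odom domx] := oX x.
split.
- by apply: filterS (open_nbhs_nbhs (conj odom domx)) => y; exact: cinvX.
- have := open_nbhs_nbhs (conj (oimX x) (imageP (chart x) domx)).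
  move=> U; near=> v; have [y domy <-] : (chart x @` cdom x) v by near: v.
  by rewrite cinvX.
- exact (cX _ _ domx).
- exact (cIX _ _ domx).
Unshelve. all: by end_near. Qed.

Lemma chartK (X : charted R) (x : X) : regular_at x ->
  chart_inv x (chart x x) = x.
Proof. by case=> /nbhs_singleton. Qed.

Lemma mulmxr_continuous m n (M : 'M[R]_(m, n)) : continuous (fun v : 'rV[R]_m
  => v *m M).
Proof. by move=> v; exact: strict_diff_continuous (strict_diff_mulmx M v). Qed.

Definition inl_mx m n : 'M[R]_(m, m + n) := row_mx 1%:M 0.
Definition inr_mx m n : 'M[R]_(n, m + n) := row_mx 0 1%:M.
Definition fst_mx m n : 'M[R]_(m + n, m) := col_mx 1%:M 0.
Definition snd_mx m n : 'M[R]_(m + n, n) := col_mx 0 1%:M.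

Lemma lsubmxE m n (v : 'rV[R]_(m + n)) : lsubmx v = v *m fst_mx m n.
Proof.
by rewrite -{2}[v]hsubmxK mul_row_col mulmx1 mulmx0 addr0.
Qed.

Lemma rsubmxE m n (v : 'rV[R]_(m + n)) : rsubmx v = v *m snd_mx m n.
Proof.
by rewrite -{2}[v]hsubmxK mul_row_col mulmx1 mulmx0 add0r.
Qed.

Lemma row_mxE m n (v : 'rV[R]_m) (w : 'rV[R]_n) :
  row_mx v w = v *m inl_mx m n + w *m inr_mx m n.
Proof. by rewrite !mul_mx_row !mulmx1 !mulmx0 add_row_mx addr0 add0r. Qed.

Lemma lsubmx_cvg m n (a : 'rV[R]_m) (b : 'rV[R]_n) :
  (@lsubmx R 1 m n) @ row_mx a b --> a.
Proof.
rewrite -[X in _ --> X](row_mxKl a b) (funext (@lsubmxE m n)).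
exact: (strict_diff_continuous (strict_diff_mulmx _ _)).
Qed.

Lemma rsubmx_cvg m n (a : 'rV[R]_m) (b : 'rV[R]_n) :
  (@rsubmx R 1 m n) @ row_mx a b --> b.
Proof.
rewrite -[X in _ --> X](row_mxKr a b) (funext (@rsubmxE m n)).
exact: (strict_diff_continuous (strict_diff_mulmx _ _)).
Qed.

Lemma row_mx_continuous (T : topologicalType) m n (f : T -> 'rV[R]_m)
    (g : T -> 'rV[R]_n) t :
  {for t, continuous f} -> {for t, continuous g} ->
  {for t, continuous (fun x => row_mx (f x) (g x))}.
Proof.
move=> fc gc; have -> : (fun x => row_mx (f x) (g x)) =
    (fun x => f x *m inl_mx m n) + (fun x => g x *m inr_mx m n).
  by apply/funext => x; rewrite row_mxE.
have mulc k (h : T -> 'rV[R]_k) (M : 'M_(k, m + n)) :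
    {for t, continuous h} -> {for t, continuous (fun x => h x *m M)}.
  by move=> hc; exact: continuous_comp hc (@mulmxr_continuous _ _ M _).
exact: continuousD (mulc _ _ _ fc) (mulc _ _ _ gc).
Qed.

Lemma pair_continuous (S T U : topologicalType) (f : S -> T) (g : S -> U) s :
  {for s, continuous f} -> {for s, continuous g} ->
  {for s, continuous (fun x => (f x, g x))}.
Proof.
move=> fc gc P [[A B] /= [fA gB] AB].
have Af : \forall x \near s, A (f x) by exact (fc _ fA).
have Bg : \forall x \near s, B (g x) by exact (gc _ gB).
change (\forall x \near s, P (f x, g x)); near=> x; apply: (AB (f x, g x)).
by split; near: x.
Unshelve. all: by end_near. Qed.

Lemma prodc_regular (X Y : charted R) (w : prodc X Y) :
  regular_at w.1 -> regular_at w.2 -> regular_at w.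
Proof.
case: w => x y /= [x1 x2 x3 x4] [y1 y2 y3 y4]; split => /=.
- exists ([set x' | chart_inv x (chart x x') = x'],
          [set y' | chart_inv y (chart y y') = y']) => //.
  by move=> -[x' y'] /= [xx' yy']; rewrite row_mxKl row_mxKr xx' yy'.
- have lc := @lsubmx_cvg _ _ (chart x x) (chart y y).
  have rc := @rsubmx_cvg _ _ (chart x x) (chart y y).
  have {}lc : \forall v \near row_mx (chart x x) (chart y y),
    chart x (chart_inv x (lsubmx v)) = lsubmx v by exact (lc _ x2).
  have {}rc : \forall v \near row_mx (chart x x) (chart y y),
    chart y (chart_inv y (rsubmx v)) = rsubmx v by exact (rc _ y2).
  by near=> v; rewrite (near lc v)// (near rc v)// hsubmxK.
- have f1 : {for (x, y), continuous (fst : X * Y -> X)} by exact: cvg_fst.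
  have f2 : {for (x, y), continuous (snd : X * Y -> Y)} by exact: cvg_snd.
  exact (row_mx_continuous (continuous_comp f1 x3) (continuous_comp f2 y3)).
- have lc := @lsubmx_cvg _ _ (chart x x) (chart y y).
  have rc := @rsubmx_cvg _ _ (chart x x) (chart y y).
  rewrite -{2}(row_mxKl (chart x x) (chart y y)) in lc.
  rewrite -{2}(row_mxKr (chart x x) (chart y y)) in rc.
  rewrite -(row_mxKl (chart x x) (chart y y)) in x4.
  rewrite -(row_mxKr (chart x x) (chart y y)) in y4.
  exact (pair_continuous (continuous_comp lc x4) (continuous_comp rc y4)).
Unshelve. all: by end_near. Qed.

Lemma euclid_regular n (x : euclid R n) : regular_at x.
Proof. by split; [near=> v|near=> v|exact: cvg_id|exact: cvg_id].
Unshelve. all: by end_near. Qed.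

(** Continuity has to be required apart: a chart takes irrelevant values outside
    its domain, so that a jump of f may be invisible in charts. *)
Definition has_jac (X Y : charted R) (f : X -> Y) (x : X)
    (M : 'M[R]_(cdim X, cdim Y)) : Prop :=
  {for x, continuous f} /\ strict_diff (in_charts f x) M (chart x x).

Lemma has_jac_tmap (X Y : charted R) (f : X -> Y) (x : X) M :
  has_jac f x M -> forall v, tmap f x v = v *m M.
Proof. by case=> _ /strict_diff_differential[]. Qed.

Lemma smooth_at_has_jac (X Y : charted R) (f : X -> Y) (x : X) :
  smooth_at f x -> exists M, has_jac f x M.
Proof.
move=> [fc [U [oU Ux _ fU]]].
by have [M fM] := Cinfty_strict_diff oU Ux fU; exists M.
Qed.

Lemma in_charts_self (X Y : charted R) (f : X -> Y) (x : X) :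
  regular_at x -> in_charts f x (chart x x) = chart (f x) (f x).
Proof. by move=> rx; rewrite /in_charts /= chartK. Qed.

Lemma near_chart (X : charted R) (x : X) (P : set X) : regular_at x ->
  (\forall y \near x, P y) -> \forall v \near chart x x, P (chart_inv x v).
Proof.
by move=> rx; case: (rx) => _ _ _ c Px; apply: c; rewrite (chartK rx).
Qed.

Lemma has_jac_near (X Y : charted R) (f g : X -> Y) (x : X) M : regular_at x ->
  (\forall y \near x, f y = g y) -> has_jac f x M -> has_jac g x M.
Proof.
move=> rx fg [fc fM]; have fgx := nbhs_singleton fg; split.
  rewrite /prop_for /continuous_at -fgx; apply: cvg_trans fc; apply: near_eq_cvg.
  exact: fg.
apply: strict_diff_near fM; near=> v.
rewrite /in_charts /= fgx; congr (chart _ _).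
near: v; exact: near_chart rx fg.
Unshelve. all: by end_near. Qed.

Lemma has_jac_comp (X Y Z : charted R) (f : X -> Y) (g : Y -> Z) (x : X) M N :
  regular_at x -> regular_at (f x) ->
  has_jac f x M -> has_jac g (f x) N -> has_jac (g \o f) x (M *m N).
Proof.
move=> rx rfx [fc fM] [gc gN]; split; first exact: continuous_comp.
rewrite -(in_charts_self f rx) in gN.
apply: strict_diff_near (strict_diff_comp fM gN); near=> v.
rewrite /in_charts /=; congr (chart _ (g _)).
near: v; apply: (near_chart (P := fun y => chart_inv (f x) (chart (f x)
  (f y)) = f y)) => //.
by case: rfx => fK _ _ _; exact: (fc _ fK).
Unshelve. all: by end_near. Qed.

Lemma has_jac_id (X : charted R) (x : X) : regular_at x -> has_jac id x 1%:M.
Proof.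
move=> rx; split; first exact: cvg_id.
apply: strict_diff_near (strict_diff_id _); near=> v.
by rewrite /in_charts /=; apply/esym; near: v; case: rx.
Unshelve. all: by end_near. Qed.

Lemma has_jac_cst (X Y : charted R) (x : X) (y : Y) : has_jac (fun=> y) x 0.
Proof.
split; first exact: cvg_cst.
move=> e e0; near=> q; rewrite /in_charts /= mulmx0 !subrr normr0.
by rewrite mulr_ge0// ltW.
Unshelve. all: by end_near. Qed.

Lemma has_jac_pair (X Y Z : charted R) (f : X -> Y) (g : X -> Z) (x : X) M N :
  has_jac f x M -> has_jac g x N ->
  has_jac (Y := prodc Y Z) (fun w => (f w, g w)) x (row_mx M N).
Proof.
move=> [fc fM] [gc gN]; split; first exact: pair_continuous.
exact: strict_diff_row_mx fM gN.
Qed.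

Lemma has_jac_fst (X Y : charted R) (w : prodc X Y) :
  regular_at w -> regular_at w.1 ->
  has_jac (X := prodc X Y) (Y := X) fst w (fst_mx _ _).
Proof.
case: w => x y rw rx; split; first exact: cvg_fst.
apply: strict_diff_near (strict_diff_mulmx _ _); near=> v.
rewrite -lsubmxE /in_charts /=.
have rv : chart ((x, y) : prodc X Y) (chart_inv ((x, y) : prodc X Y) v) = v.
  by near: v; case: rw.
by rewrite -{1}rv /= row_mxKl.
Unshelve. all: by end_near. Qed.

Lemma has_jac_snd (X Y : charted R) (w : prodc X Y) :
  regular_at w -> regular_at w.2 ->
  has_jac (X := prodc X Y) (Y := Y) snd w (snd_mx _ _).
Proof.
case: w => x y rw rx; split; first exact: cvg_snd.
apply: strict_diff_near (strict_diff_mulmx _ _); near=> v.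
rewrite -rsubmxE /in_charts /=.
have rv : chart ((x, y) : prodc X Y) (chart_inv ((x, y) : prodc X Y) v) = v.
  by near: v; case: rw.
by rewrite -{1}rv /= row_mxKr.
Unshelve. all: by end_near. Qed.

(** This is [level_set_kernel] for the differences of a and b and of k and l in
    charts; charts being injective on their domains, points near x where the
    first difference vanishes satisfy a y = b y. *)
Lemma equalizer_kernel (X Y Z : charted R) (a b : X -> Z) (k l : X -> Y)
    (x : X) Ma Mb Nk Nl (w : 'rV[R]_(cdim X)) :
  regular_at x -> regular_at (a x) ->
  has_jac a x Ma -> has_jac b x Mb -> has_jac k x Nk -> has_jac l x Nl ->
  a x = b x -> row_full (Ma - Mb) ->
  (\forall y \near x, a y = b y -> k y = l y) ->
  w *m Ma = w *m Mb -> w *m Nk = w *m Nl.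
Proof.
move=> rx ra [ac aM] [bc bM] [kc kM] [lc lM] abx full abkl wab.
have klx := nbhs_singleton abkl abx.
apply/eqP; rewrite -subr_eq0 -mulmxBr; apply/eqP.
apply: (level_set_kernel (strict_diffB aM bM) full (strict_diffB kM lM));
  last first.
  by rewrite mulmxBr wab subrr.
have aK : \forall v \near chart x x,
    chart_inv (a x) (chart (a x) (a (chart_inv x v))) = a (chart_inv x v).
  apply: (near_chart (P := fun y => chart_inv (a x) (chart (a x) (a y)) =
    a y)) => //.
  by case: ra => fK _ _ _; exact: (ac _ fK).
have bK : \forall v \near chart x x,
    chart_inv (a x) (chart (a x) (b (chart_inv x v))) = b (chart_inv x v).
  apply: (near_chart (P := fun y => chart_inv (a x) (chart (a x) (b y)) =
    b y)) => //.
  by rewrite abx in ra *; case: ra => fK _ _ _; exact: (bc _ fK).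
have := near_chart rx abkl => abv.
near=> v; rewrite !in_charts_self// -abx -klx !subrr /in_charts /= -abx -klx.
move=> /subr0_eq ab; rewrite (near abv v)// ?subrr//.
by rewrite -(near aK v)// -(near bK v)// ab.
Unshelve. all: by end_near. Qed.

End Charts.

Section Jacobians.
Context {R : realType}.

Definition strict_at (X Y : charted R) (f : X -> Y) (x : X) : Prop :=
  exists M, has_jac f x M.

(** The matrix of the tangent map is only characterised by its action on tangent
    vectors: no computation depends on how differentials are chosen. *)
Fact tangent_matrix : {J : forall X Y : charted R, (X -> Y) -> X ->
    'M[R]_(cdim X, cdim Y) | forall (X Y : charted R) (f : X -> Y)
      (x : X) v, tmap f x v = v *m J X Y f x}.
Proof.
by exists (fun X Y f x => lin1_mx (tmap f x)) => *; rewrite mul_rV_lin1.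
Qed.

Definition jac (X Y : charted R) (f : X -> Y) (x : X) : 'M[R]_(cdim X, cdim Y) :=
  sval tangent_matrix X Y f x.

Lemma tmapE (X Y : charted R) (f : X -> Y) (x : X) v : tmap f x v = v *m jac f x.
Proof. exact: (svalP tangent_matrix). Qed.

Lemma has_jac_eq (X Y : charted R) (f : X -> Y) (x : X) M : has_jac f x M ->
  jac f x = M.
Proof.
by move=> fM; apply/row_matrixP => i; rewrite !rowE -tmapE; exact: has_jac_tmap.
Qed.

Lemma jacP (X Y : charted R) (f : X -> Y) (x : X) : strict_at f x ->
  has_jac f x (jac f x).
Proof. by move=> [M fM]; rewrite (has_jac_eq fM). Qed.

Lemma strict_at_comp (X Y Z : charted R) (f : X -> Y) (g : Y -> Z) (x : X) :
  regular_at x -> regular_at (f x) -> strict_at f x -> strict_at g (f x) ->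
  strict_at (g \o f) x.
Proof.
by move=> rx ry [M fM] [N gN]; exists (M *m N); exact: has_jac_comp.
Qed.

Lemma jac_comp (X Y Z : charted R) (f : X -> Y) (g : Y -> Z) (x : X) :
  regular_at x -> regular_at (f x) -> strict_at f x -> strict_at g (f x) ->
  jac (g \o f) x = jac f x *m jac g (f x).
Proof.
move=> rx ry [M fM] [N gN].
by rewrite (has_jac_eq (has_jac_comp rx ry fM gN)) (has_jac_eq fM)
  (has_jac_eq gN).
Qed.

Lemma strict_at_near (X Y : charted R) (f g : X -> Y) (x : X) : regular_at x ->
  (\forall y \near x, f y = g y) -> strict_at f x -> strict_at g x.
Proof. by move=> rx fg [M fM]; exists M; exact: has_jac_near fM. Qed.

Lemma jac_near (X Y : charted R) (f g : X -> Y) (x : X) : regular_at x ->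
  (\forall y \near x, f y = g y) -> strict_at f x -> jac f x = jac g x.
Proof.
move=> rx fg [M fM].
by rewrite (has_jac_eq fM) (has_jac_eq (has_jac_near rx fg fM)).
Qed.

Lemma strict_at_id (X : charted R) (x : X) : regular_at x -> strict_at (@id X) x.
Proof. by move=> rx; exists 1%:M; exact: has_jac_id. Qed.

Lemma jac_id (X : charted R) (x : X) : regular_at x -> jac (@id X) x = 1%:M.
Proof. by move=> /has_jac_id/has_jac_eq. Qed.

Lemma strict_at_pair (X Y Z : charted R) (f : X -> Y) (g : X -> Z) (x : X) :
  strict_at f x -> strict_at g x ->
  strict_at (Y := prodc Y Z) (fun w => (f w, g w)) x.
Proof. by move=> [M fM] [N gN]; exists (row_mx M N); exact: has_jac_pair. Qed.

Lemma jac_pair (X Y Z : charted R) (f : X -> Y) (g : X -> Z) (x : X) :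
  strict_at f x -> strict_at g x ->
  jac (Y := prodc Y Z) (fun w => (f w, g w)) x = row_mx (jac f x) (jac g x).
Proof. by move=> /jacP fM /jacP gN; exact: has_jac_eq (has_jac_pair fM gN). Qed.

Lemma strict_at_fst (X Y : charted R) (w : prodc X Y) :
  regular_at w -> regular_at w.1 -> strict_at (X := prodc X Y) (Y := X) fst w.
Proof. by move=> rw rx; exists (fst_mx _ _); exact: has_jac_fst. Qed.

Lemma jac_fst (X Y : charted R) (w : prodc X Y) :
  regular_at w -> regular_at w.1 -> jac (X := prodc X Y) (Y := X) fst w =
    fst_mx _ _.
Proof. by move=> rw rx; exact: has_jac_eq (has_jac_fst rw rx). Qed.

Lemma strict_at_snd (X Y : charted R) (w : prodc X Y) :
  regular_at w -> regular_at w.2 -> strict_at (X := prodc X Y) (Y := Y) snd w.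
Proof. by move=> rw rx; exists (snd_mx _ _); exact: has_jac_snd. Qed.

Lemma jac_snd (X Y : charted R) (w : prodc X Y) :
  regular_at w -> regular_at w.2 -> jac (X := prodc X Y) (Y := Y) snd w =
    snd_mx _ _.
Proof. by move=> rw rx; exact: has_jac_eq (has_jac_snd rw rx). Qed.

Lemma row_full_surj m n (M : 'M[R]_(m, n)) :
  (forall u : 'rV_n, exists w : 'rV_m, w *m M = u) -> row_full M.
Proof.
move=> surj; rewrite -sub1mx; apply/row_subP => i.
by have [w <-] := surj (row i 1%:M); exact: submxMl.
Qed.

(** Near j z, the maps j \o r and id agree on the equalizer of a and b;
    transversality extends this to the tangent vectors equalized by the
    differentials of a and b. *)
Lemma fibre_product_tangent (P X Z : charted R) (j : P -> X) (r : X -> P)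
    (a b : X -> Z) (z : P) :
  regular_at z -> regular_at (j z) -> regular_at (a (j z)) ->
  strict_at j z -> strict_at r (j z) -> strict_at a (j z) -> strict_at b (j z) ->
  a (j z) = b (j z) ->
  (\forall z' \near z, r (j z') = z') ->
  (\forall w \near j z, a w = b w -> j (r w) = w) ->
  row_full (jac a (j z) - jac b (j z)) ->
  jac j z *m jac r (j z) = 1%:M /\
  (forall w : 'rV_(cdim X), w *m jac a (j z) = w *m jac b (j z) ->
     w *m jac r (j z) *m jac j z = w).
Proof.
move=> rz rj ra jz rjz aj bj abj rjK jrK full; have rjz1 := nbhs_singleton rjK.
split=> [|w abw].
  rewrite -jac_comp// (jac_near _ rjK) ?jac_id//; exact: strict_at_comp.
have rr : regular_at (r (j z)) by rewrite rjz1.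
have jr : strict_at j (r (j z)) by rewrite rjz1.
have := jac_comp rj rr rjz jr; rewrite rjz1 -mulmxA => <-.
rewrite -[RHS]mulmx1 -(jac_id rj).
apply: (equalizer_kernel rj ra (jacP aj) (jacP bj) _ _ abj full jrK abw).
- by apply: jacP; exact: strict_at_comp.
- by apply: jacP; exact: strict_at_id.
Qed.

End Jacobians.

(** * Vector bundles and groupoids *)

Section Structures.
Context {R : realType}.

Lemma linear_map0 (U W : lmodType R) (h : U -> W) : linear h -> h 0 = 0.
Proof.
by move=> hl; have := hl (-1) 0 0; rewrite !scaleN1r oppr0 add0r addNr.
Qed.

Lemma linear_sub (U W : lmodType R) (h : U -> W) a b : linear h ->
  h (a - b) = h a - h b.
Proof.
move=> hl; have := hl (-1) b a; rewrite !scaleN1r [- b + a]addrC.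
by rewrite [- h b + _]addrC.
Qed.

Lemma linear_add (U W : lmodType R) (h : U -> W) a b : linear h ->
  h (a + b) = h a + h b.
Proof. by move=> hl; have := hl 1 a b; rewrite !scale1r. Qed.

Lemma smooth_strict_at (X Y : charted R) (f : X -> Y) (x : X) : smooth f ->
  strict_at f x.
Proof. by move=> /(_ x)/smooth_at_has_jac. Qed.

Lemma src_smooth (G : lieGroupoid R) : smooth (@src R G).
Proof. by case: G => ? ? ? ? ? ? ? []. Qed.
Lemma tgt_smooth (G : lieGroupoid R) : smooth (@tgt R G).
Proof. by case: G => ? ? ? ? ? ? ? ? []. Qed.
Lemma unt_smooth (G : lieGroupoid R) : smooth (@unt R G).
Proof. by case: G. Qed.
Lemma inv_smooth (G : lieGroupoid R) : smooth (@inv R G).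
Proof. by case: G. Qed.
Lemma src_unt (G : lieGroupoid R) (x : obj G) : src (unt x) = x.
Proof. by case: G x => ? ? ? ? ? ? ? ? ? ? ? ? su ? ? ? ? ? x; case: (su x). Qed.
Lemma tgt_unt (G : lieGroupoid R) (x : obj G) : tgt (unt x) = x.
Proof. by case: G x => ? ? ? ? ? ? ? ? ? ? ? ? su ? ? ? ? ? x; case: (su x). Qed.
Lemma src_inv (G : lieGroupoid R) (g : arr G) : src (inv g) = tgt g.
Proof. by case: G g => ? ? ? ? ? ? ? ? ? ? ? ? ? ? ? ? si ? g; case: (si g). Qed.
Lemma tgt_inv (G : lieGroupoid R) (g : arr G) : tgt (inv g) = src g.
Proof. by case: G g => ? ? ? ? ? ? ? ? ? ? ? ? ? ? ? ? si ? g; case: (si g). Qed.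
Lemma inv_unt (G : lieGroupoid R) (x : obj G) : inv (unt x) = unt x.
Proof.
have := tgt_inv (unt x); rewrite src_unt; have := tgt_unt x.
case: G x => a o s t u i m ? ? ? ? ? ? ? ? ul ? im x /= tx tix.
by have [mx _] := ul (i (u x)); have [+ _] := im (u x); rewrite tx -{1}tix mx.
Qed.

Section Morphisms.
Context {H G : lieGroupoid R} (f : lgMorphism H G).
Lemma on_arr_smooth : smooth (on_arr f). Proof. by case: f. Qed.
Lemma on_obj_smooth : smooth (on_obj f). Proof. by case: f. Qed.
Lemma src_on_arr h : src (on_arr f h) = on_obj f (src h).
Proof. by case: f h. Qed.
Lemma tgt_on_arr h : tgt (on_arr f h) = on_obj f (tgt h).
Proof. by case: f h. Qed.
Lemma on_arr_unt y : on_arr f (unt y) = unt (on_obj f y).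
Proof. by case: f y. Qed.
End Morphisms.

Section Bundles.
Context {E B : manifold R} (V : vbundle E B).

Lemma proj_smooth : smooth (proj V). Proof. by case: V. Qed.

Lemma incl_inj b : injective (@incl R E B V b).
Proof. by case: V b. Qed.

Lemma projP b e : proj V e = b <-> exists v : fib V b, incl v = e.
Proof. by case: V b e. Qed.

Lemma proj_incl b (v : fib V b) : proj V (incl v) = b.
Proof. by apply/projP; exists v. Qed.

Lemma inclP e : exists v : fib V (proj V e), incl v = e.
Proof. exact/projP. Qed.

Lemma local_trivialization b0 : exists (U : set B) (phi : E -> euclid R (rank V))
        (psi : prodc B (euclid R (rank V)) -> E),
      [/\ open U /\ U b0,
          forall e, U (proj V e) -> smooth_at phi e,
          forall b c, U b ->
            [/\ smooth_at psi (b, c), proj V (psi (b, c)) = b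
              & phi (psi (b, c)) = c],
          forall e, U (proj V e) -> psi (proj V e, phi e) = e
        & forall b, U b ->
            linear (fun v : fib V b => phi (incl v) : 'rV[R]_(rank V))].
Proof. by case: V b0. Qed.

Definition zero_section (b : B) : E := incl (0 : fib V b).

Lemma proj_zero b : proj V (zero_section b) = b.
Proof. exact: proj_incl. Qed.

Lemma incl_eq_zero b (v : fib V b) : incl v = zero_section b -> v = 0.
Proof. exact: incl_inj. Qed.

(** In a local trivialisation the zero section is b |-> (b, 0). *)
Lemma zero_section_strict b : strict_at zero_section b.
Proof.
have [U [phi [psi [[oU Ub] _ psiP phiK phil]]]] := local_trivialization b.
have [psib _ _] := psiP b 0 Ub.
have zE : \forall b' \near b, psi (b', 0) = zero_section b'.
  apply: filterS (open_nbhs_nbhs (conj oU Ub)) => b' Ub'.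
  rewrite -[RHS]phiK ?proj_zero//; congr (psi (_, _)).
  by rewrite (linear_map0 (phil _ Ub')).
have rb := manifold_regular b.
apply: strict_at_near zE _ => //.
pose c : euclid R (rank V) := 0.
have rbc : regular_at ((b, c) : prodc B (euclid R (rank V))).
  exact (prodc_regular (w := (b, c)) rb (euclid_regular c)).
have cc : strict_at (fun=> c) b by exists 0; exact: has_jac_cst.
exact (strict_at_comp rb rbc (strict_at_pair (strict_at_id rb) cc)
  (smooth_at_has_jac psib)).
Qed.

Lemma jac_proj_zero b :
  jac zero_section b *m jac (proj V) (zero_section b) = 1%:M.
Proof.
have rb := manifold_regular b; have rz := manifold_regular (zero_section b).
rewrite -jac_comp//; [|exact: zero_section_strict|
  exact: smooth_strict_at proj_smooth].
rewrite (_ : _ \o _ = id) ?jac_id//.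
by apply/funext => b' /=; rewrite proj_zero.
Qed.

End Bundles.

Section FibrewiseLinear.
Context {E B E' B' : manifold R} {V : vbundle E B} {V' : vbundle E' B'}.
Context {F : E -> E'} {f : B -> B'} (Ff : fibrewise_linear V V' F f).

Lemma fibrewise_proj e : proj V' (F e) = f (proj V e).
Proof.
have [v ve] := inclP V e; have [Fx Fxv] := Ff (proj V e).
by rewrite -{1}ve Fxv proj_incl.
Qed.

Lemma fibrewise_zero b : F (zero_section V b) = zero_section V' (f b).
Proof. by have [Fx Fxv] := Ff b; rewrite /zero_section Fxv linear0. Qed.

End FibrewiseLinear.

Section VBG.
Context (W : vbGroupoid R).
Lemma src_linear : fibrewise_linear (vb_arr W) (vb_obj W) (@src R (total W))
  (@src R (base W)).
Proof. by case: W. Qed.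
Lemma tgt_linear : fibrewise_linear (vb_arr W) (vb_obj W) (@tgt R (total W))
  (@tgt R (base W)).
Proof. by case: W. Qed.
Lemma unt_linear : fibrewise_linear (vb_obj W) (vb_arr W) (@unt R (total W))
  (@unt R (base W)).
Proof. by case: W. Qed.
End VBG.

Lemma mor_arr_linear (W V : vbGroupoid R) (F : vbgMorphism W V) :
  fibrewise_linear (vb_arr W) (vb_arr V) (on_arr (mor_total F))
    (on_arr (mor_base F)).
Proof. by case: F. Qed.
Lemma mor_obj_linear (W V : vbGroupoid R) (F : vbgMorphism W V) :
  fibrewise_linear (vb_obj W) (vb_obj V) (on_obj (mor_total F))
    (on_obj (mor_base F)).
Proof. by case: F. Qed.

End Structures.

(** * The fibre product attached to a groupoid morphism *)

Section Anchors.
Context {R : realType}.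

Lemma regular_prod (X Y : manifold R) (w : prodc X Y) : regular_at w.
Proof. exact (prodc_regular (manifold_regular w.1) (manifold_regular w.2)). Qed.

Lemma regular_prod3 (X Y Z : manifold R) (w : prodc X (prodc Y Z)) : regular_at w.
Proof. exact (prodc_regular (manifold_regular w.1) (regular_prod w.2)). Qed.

Lemma row_mx_fst m n (v : 'rV[R]_m) (w : 'rV[R]_n) : row_mx v w *m fst_mx m n = v.
Proof. by rewrite -lsubmxE row_mxKl. Qed.

Lemma row_mx_snd m n (v : 'rV[R]_m) (w : 'rV[R]_n) : row_mx v w *m snd_mx m n = w.
Proof. by rewrite -rsubmxE row_mxKr. Qed.

Lemma row_mx_fst_pair m n p q (a : 'rV[R]_m) (b : 'rV[R]_n) (A : 'M_(m, p))
    (B : 'M_(m, q)) :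
  row_mx a b *m row_mx (fst_mx m n *m A) (fst_mx m n *m B) =
  row_mx (a *m A) (a *m B).
Proof. by rewrite mul_mx_row !mulmxA row_mx_fst. Qed.

Lemma row_mx_snd_pair m n k p q (a : 'rV[R]_m) (b : 'rV[R]_n) (c : 'rV[R]_k)
    (A : 'M_(n, p)) (B : 'M_(k, q)) :
  row_mx a (row_mx b c) *m
    row_mx (snd_mx m (n + k) *m fst_mx n k *m A)
      (snd_mx m (n + k) *m snd_mx n k *m B) =
  row_mx (b *m A) (c *m B).
Proof. by rewrite mul_mx_row !mulmxA row_mx_snd row_mx_fst row_mx_snd. Qed.

Section FibreProduct.
Context {H G : lieGroupoid R} (f : lgMorphism H G).

Let X : charted R := prodc (arr G) (prodc (obj H) (obj H)).

(** In a Morita map, the arrows of H are embedded in this way as the fibre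
    product of the pairs (source, target) of G and f x f, that is, as the
    equalizer of [arr_ends] and [obj_ends]. *)
Definition anchor_incl (h : arr H) : X := (on_arr f h, (src h, tgt h)).

Definition arr_ends (w : X) : prodc (obj G) (obj G) := (src w.1, tgt w.1).

Definition obj_ends (w : X) : prodc (obj G) (obj G) :=
  (on_obj f w.2.1, on_obj f w.2.2).

Lemma anchor_incl_ends h : arr_ends (anchor_incl h) = obj_ends (anchor_incl h).
Proof. by rewrite /arr_ends /obj_ends /= src_on_arr tgt_on_arr. Qed.

Lemma anchor_incl_strict h : strict_at anchor_incl h.
Proof.
exact (strict_at_pair (smooth_strict_at h (on_arr_smooth f))
  (strict_at_pair (smooth_strict_at h (@src_smooth _ _))
    (smooth_strict_at h (@tgt_smooth _ _)))).
Qed.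

Lemma jac_anchor_incl h :
  jac anchor_incl h =
    row_mx (jac (on_arr f) h)
      (row_mx (jac (@src R H) h) (jac (@tgt R H) h)).
Proof.
have cs := smooth_strict_at h (@src_smooth _ H).
have ct := smooth_strict_at h (@tgt_smooth _ H).
have -> := jac_pair (smooth_strict_at h (on_arr_smooth f)) (strict_at_pair cs ct).
by have -> := jac_pair cs ct.
Qed.

Let rX (w : X) : regular_at w := regular_prod3 w.

Let fstX_strict (w : X) : strict_at (X := X) (Y := arr G) fst w.
Proof. exact (strict_at_fst (rX w) (manifold_regular w.1)). Qed.

Let sndX_strict (w : X) : strict_at (X := X) (Y := prodc (obj H) (obj H)) snd w.
Proof. exact (strict_at_snd (rX w) (regular_prod w.2)). Qed.

Let fstsndX_strict (w : X) : strict_at (X := X) (Y := obj H) (fst \o snd) w.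
Proof.
exact (strict_at_comp (rX w) (regular_prod w.2) (sndX_strict w)
  (strict_at_fst (regular_prod w.2) (manifold_regular w.2.1))).
Qed.

Let sndsndX_strict (w : X) : strict_at (X := X) (Y := obj H) (snd \o snd) w.
Proof.
exact (strict_at_comp (rX w) (regular_prod w.2) (sndX_strict w)
  (strict_at_snd (regular_prod w.2) (manifold_regular w.2.2))).
Qed.

Lemma arr_ends_strict w : strict_at arr_ends w.
Proof.
have cs := smooth_strict_at w.1 (@src_smooth _ G).
have ct := smooth_strict_at w.1 (@tgt_smooth _ G).
exact (strict_at_pair (strict_at_comp (rX w) (manifold_regular w.1)
  (fstX_strict w) cs)
  (strict_at_comp (rX w) (manifold_regular w.1) (fstX_strict w) ct)).
Qed.

Lemma jac_arr_ends w (a : 'rV_(cdim (arr G)))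
  (b : 'rV_(cdim (obj H) + cdim (obj H))) :
  row_mx a b *m jac arr_ends w =
  row_mx (a *m jac (@src R G) w.1) (a *m jac (@tgt R G) w.1).
Proof.
have cs := smooth_strict_at w.1 (@src_smooth _ G).
have ct := smooth_strict_at w.1 (@tgt_smooth _ G).
have r1 := manifold_regular w.1.
have -> : jac arr_ends w = _ := jac_pair (strict_at_comp (rX w) r1
  (fstX_strict w) cs)
  (strict_at_comp (rX w) r1 (fstX_strict w) ct).
have -> := jac_comp (rX w) r1 (fstX_strict w) cs.
have -> := jac_comp (rX w) r1 (fstX_strict w) ct.
have -> := jac_fst (rX w) r1.
exact (row_mx_fst_pair a b (jac (@src R G) w.1) (jac (@tgt R G) w.1)).
Qed.

Lemma obj_ends_strict w : strict_at obj_ends w.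
Proof.
have c1 := smooth_strict_at w.2.1 (on_obj_smooth f).
have c2 := smooth_strict_at w.2.2 (on_obj_smooth f).
exact (strict_at_pair (strict_at_comp (rX w) (manifold_regular w.2.1)
  (fstsndX_strict w) c1)
  (strict_at_comp (rX w) (manifold_regular w.2.2) (sndsndX_strict w) c2)).
Qed.

Lemma jac_obj_ends w (a : 'rV_(cdim (arr G))) (b c : 'rV_(cdim (obj H))) :
  row_mx a (row_mx b c) *m jac obj_ends w =
  row_mx (b *m jac (on_obj f) w.2.1) (c *m jac (on_obj f) w.2.2).
Proof.
have c1 := smooth_strict_at w.2.1 (on_obj_smooth f).
have c2 := smooth_strict_at w.2.2 (on_obj_smooth f).
have r1 := manifold_regular w.2.1; have r2 := manifold_regular w.2.2.
have r := regular_prod w.2.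
have -> : jac obj_ends w = _ := jac_pair (strict_at_comp (rX w) r1
  (fstsndX_strict w) c1)
  (strict_at_comp (rX w) r2 (sndsndX_strict w) c2).
have -> := jac_comp (rX w) r1 (fstsndX_strict w) c1.
have -> := jac_comp (rX w) r2 (sndsndX_strict w) c2.
have -> := jac_comp (rX w) r (sndX_strict w) (strict_at_fst r r1).
have -> := jac_comp (rX w) r (sndX_strict w) (strict_at_snd r r2).
have -> := jac_snd (rX w) r; have -> := jac_fst r r1; have -> := jac_snd r r2.
exact (row_mx_snd_pair a b c (jac (on_obj f) w.2.1) (jac (on_obj f) w.2.2)).
Qed.

End FibreProduct.

End Anchors.

(** * The base of a VB-Morita map *)

Section BaseMaps.
Context {R : realType}.

Lemma jac_unt_src (G : lieGroupoid R) (x : obj G) :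
  jac (@unt R G) x *m jac (@src R G) (unt x) = 1%:M.
Proof.
have rx := manifold_regular x; have ru := manifold_regular (unt x).
rewrite -(jac_comp rx ru (smooth_strict_at x (@unt_smooth _ G))
  (smooth_strict_at _ (@src_smooth _ G))).
rewrite (_ : _ \o _ = id) ?jac_id//.
by apply/funext => x' /=; rewrite src_unt.
Qed.

Lemma jac_unt_tgt (G : lieGroupoid R) (x : obj G) :
  jac (@unt R G) x *m jac (@tgt R G) (unt x) = 1%:M.
Proof.
have rx := manifold_regular x; have ru := manifold_regular (unt x).
rewrite -(jac_comp rx ru (smooth_strict_at x (@unt_smooth _ G))
  (smooth_strict_at _ (@tgt_smooth _ G))).
rewrite (_ : _ \o _ = id) ?jac_id//.
by apply/funext => x' /=; rewrite tgt_unt.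
Qed.

Lemma jac_inv_src (G : lieGroupoid R) (x : obj G) :
  jac (@inv R G) (unt x) *m jac (@src R G) (unt x) = jac (@tgt R G) (unt x).
Proof.
have ru := manifold_regular (unt x); have ri := manifold_regular (inv (unt x)).
have := jac_comp ru ri (smooth_strict_at _ (@inv_smooth _ G))
  (smooth_strict_at _ (@src_smooth _ G)).
rewrite inv_unt => <-; congr (jac _ _).
by apply/funext => g /=; rewrite src_inv.
Qed.

Lemma jac_inv_tgt (G : lieGroupoid R) (x : obj G) :
  jac (@inv R G) (unt x) *m jac (@tgt R G) (unt x) = jac (@src R G) (unt x).
Proof.
have ru := manifold_regular (unt x); have ri := manifold_regular (inv (unt x)).
have := jac_comp ru ri (smooth_strict_at _ (@inv_smooth _ G))
  (smooth_strict_at _ (@tgt_smooth _ G)).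
rewrite inv_unt => <-; congr (jac _ _).
by apply/funext => g /=; rewrite tgt_inv.
Qed.

Lemma jac_on_arr_src (H G : lieGroupoid R) (f : lgMorphism H G) y :
  jac (on_arr f) (unt y) *m jac (@src R G) (unt (on_obj f y)) =
  jac (@src R H) (unt y) *m jac (on_obj f) y.
Proof.
have ru := manifold_regular (unt y).
have := jac_comp ru (manifold_regular (on_arr f (unt y)))
  (smooth_strict_at _ (on_arr_smooth f)) (smooth_strict_at _ (@src_smooth _ _)).
have := jac_comp ru (manifold_regular (src (unt y)))
  (smooth_strict_at _ (@src_smooth _ _)) (smooth_strict_at _ (on_obj_smooth f)).
rewrite on_arr_unt src_unt => <- <-; congr (jac _ _).
by apply/funext => h /=; rewrite src_on_arr.
Qed.

Lemma jac_on_arr_tgt (H G : lieGroupoid R) (f : lgMorphism H G) y :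
  jac (on_arr f) (unt y) *m jac (@tgt R G) (unt (on_obj f y)) =
  jac (@tgt R H) (unt y) *m jac (on_obj f) y.
Proof.
have ru := manifold_regular (unt y).
have := jac_comp ru (manifold_regular (on_arr f (unt y)))
  (smooth_strict_at _ (on_arr_smooth f)) (smooth_strict_at _ (@tgt_smooth _ _)).
have := jac_comp ru (manifold_regular (tgt (unt y)))
  (smooth_strict_at _ (@tgt_smooth _ _)) (smooth_strict_at _ (on_obj_smooth f)).
rewrite on_arr_unt tgt_unt => <- <-; congr (jac _ _).
by apply/funext => h /=; rewrite tgt_on_arr.
Qed.

(** Vectors at which only the target is controlled suffice to reach all pairs
    (source, target): the differential I of the inversion at a unit exchanges
    the roles of S and T. *)
Lemma transverse_ends m n k (S T : 'M[R]_(m, n)) (I : 'M_m) (A : 'M_(k, n))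
    (a a' : 'rV_m) (v v' : 'rV_k) :
  I *m S = T -> I *m T = S -> a *m S = v *m A -> a' *m S = v' *m A ->
  row_mx ((a + a' *m I) *m S) ((a + a' *m I) *m T) - row_mx (v *m A) (v' *m A) =
  row_mx (a' *m T) (a *m T).
Proof.
move=> IS IT aS aS'; rewrite !mulmxDl -!mulmxA IS IT aS aS'.
by rewrite opp_row_mx add_row_mx addrAC subrr add0r addrK.
Qed.

Section Morita.
Context {L' L : vbGroupoid R} (F : vbgMorphism L' L) (hF : is_vb_morita F).

Let G := base L.
Let H := base L'.
Let f := mor_base F.
Let tF := mor_total F.
Local Notation X := (prodc (arr G) (prodc (obj H) (obj H))).
Local Notation zL := (zero_section (vb_arr L)).
Local Notation zM := (zero_section (vb_obj L)).
Local Notation zL' := (zero_section (vb_arr L')).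
Local Notation zN := (zero_section (vb_obj L')).

(** The zero sections carry the fibre product of the bases into that of the
    total groupoids. *)
Let zmap (w : X) : prodc (arr (total L)) (prodc (obj (total L'))
  (obj (total L'))) :=
  (zL w.1, (zN w.2.1, zN w.2.2)).

Let zmap_strict w : strict_at zmap w.
Proof.
have r2 := regular_prod w.2; have rw := regular_prod3 w.
have c1 := strict_at_comp rw (manifold_regular w.1)
  (strict_at_fst rw (manifold_regular _)) (zero_section_strict (vb_arr L) w.1).
have s2 := strict_at_snd rw r2.
have c21 := strict_at_comp rw (manifold_regular w.2.1)
  (strict_at_comp rw r2 s2 (strict_at_fst r2 (manifold_regular _)))
  (zero_section_strict (vb_obj L') w.2.1).
have c22 := strict_at_comp rw (manifold_regular w.2.2)
  (strict_at_comp rw r2 s2 (strict_at_snd r2 (manifold_regular _)))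
  (zero_section_strict (vb_obj L') w.2.2).
exact (strict_at_pair c1 (strict_at_pair c21 c22)).
Qed.

Let zmap_incl h : zmap (anchor_incl f h) = anchor_incl tF (zL' h).
Proof.
rewrite /zmap /anchor_incl /= (fibrewise_zero (mor_arr_linear F)).
by rewrite (fibrewise_zero (@src_linear _ L'))
  (fibrewise_zero (@tgt_linear _ L')).
Qed.

Let proj_anchor_incl e w : anchor_incl tF e = zmap w ->
  anchor_incl f (proj (vb_arr L') e) = w.
Proof.
case: w => g [y1 y2] [eg ey1 ey2].
rewrite /anchor_incl -(fibrewise_proj (mor_arr_linear F)) eg proj_zero.
rewrite -(fibrewise_proj (@src_linear _ L')) ey1 proj_zero.
by rewrite -(fibrewise_proj (@tgt_linear _ L')) ey2 proj_zero.
Qed.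

Let zmap_ends w : arr_ends w = obj_ends f w -> arr_ends (zmap w) =
  obj_ends tF (zmap w).
Proof.
case: w => g [y1 y2] [/= sg tg]; rewrite /arr_ends /obj_ends /=.
rewrite !(fibrewise_zero (mor_obj_linear F)).
rewrite (fibrewise_zero (@src_linear _ L)) (fibrewise_zero (@tgt_linear _ L)).
by rewrite sg tg.
Qed.

Lemma total_anchor_incl_inj : injective (anchor_incl tF).
Proof. by case: hF => [[]]. Qed.

Lemma base_anchor_incl_inj : injective (anchor_incl f).
Proof.
move=> h h' hh'; rewrite -[h](proj_zero (vb_arr L')) -[h'](proj_zero (vb_arr L')).
by congr proj; apply: total_anchor_incl_inj; rewrite -!zmap_incl hh'.
Qed.

(** Follow the zero sections into the total fibre product, invert its embedding
    there, and project the resulting arrow of L' to H. *)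
Lemma base_retraction h : exists r : X -> arr H,
  [/\ strict_at r (anchor_incl f h),
      \forall h' \near h, r (anchor_incl f h') = h'
    & \forall w \near anchor_incl f h,
        arr_ends w = obj_ends f w -> anchor_incl f (r w) = w].
Proof.
have [[_ _ _ /(_ (zL' h))[rt [rts rtK]]] _] := hF.
rewrite -/(anchor_incl tF _) in rts rtK.
have jc := anchor_incl_strict f h.
have zc := zmap_strict (anchor_incl f h).
have rtc := smooth_at_has_jac rts.
have rtzK : \forall w \near anchor_incl f h, arr_ends w = obj_ends f w ->
    anchor_incl tF (rt (zmap w)) = zmap w.
  have [_ [zcont _]] := zc; rewrite -zmap_incl in rtK.
  have := zcont _ rtK; rewrite /= => zrtK.
  near=> w => wS; have : arr_ends (zmap w) = obj_ends tF (zmap w)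
    by exact: zmap_ends.
  by near: w; exact: zrtK.
exists (proj (vb_arr L') \o rt \o zmap); split.
- rewrite -zmap_incl in rtc.
  have rw := regular_prod3 (anchor_incl f h).
  have rz := regular_prod3 (zmap (anchor_incl f h)).
  have rr := manifold_regular (rt (zmap (anchor_incl f h))).
  exact (strict_at_comp rw rz zc (strict_at_comp rz rr rtc (smooth_strict_at _
    (@proj_smooth _ _ _ _)))).
- have [_ [jcont _]] := jc.
  have := jcont _ rtzK => jrtzK.
  near=> h' => /=; apply: base_anchor_incl_inj; apply: proj_anchor_incl.
  have : arr_ends (anchor_incl f h') = obj_ends f (anchor_incl f h')
    by exact: anchor_incl_ends.
  by near: h'; exact: jrtzK.
- near=> w => wS /=; apply: proj_anchor_incl.
  by move: wS; near: w; exact: rtzK.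
Unshelve. all: by end_near. Qed.

(** Move u to the zero vector over f y along the zero section, solve the equation
    there by means of the submersion that F provides, and project the solution
    to the bases. *)
Lemma base_submersion y (u : 'rV[R]_(cdim (obj G))) :
  exists (a : 'rV[R]_(cdim (arr G))) (v : 'rV[R]_(cdim (obj H))),
    a *m jac (@src R G) (unt (on_obj f y)) = v *m jac (on_obj f) y /\
    a *m jac (@tgt R G) (unt (on_obj f y)) = u.
Proof.
have [_ [P [p [q [[pqs _ pqS _] _ [_ tsub]]]]]] := hF.
set x := on_obj f y.
have xS : src (unt (zM x)) = on_obj tF (zN y).
  by rewrite src_unt (fibrewise_zero (mor_obj_linear F)).
have [z [zp zq]] : exists z, p z = unt (zM x) /\ q z = zN y.
  have : [set w : arr (total L) * obj (total L') | src w.1 =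
    on_obj tF w.2] (unt (zM x), zN y).
    exact: xS.
  by rewrite -pqS => -[z _ [zp zq]]; exists z.
have pzE : p z = zL (unt x) by rewrite zp (fibrewise_zero (@unt_linear _ L)).
have rz := manifold_regular z; have rpz := manifold_regular (p z).
have rqz := manifold_regular (q z).
have pqc := smooth_strict_at z pqs.
pose PQ : charted R := prodc (arr (total L)) (obj (total L')).
pose pq (z : P) : PQ := (p z, q z).
have rpq := regular_prod (pq z).
have pc : strict_at p z.
  exact (strict_at_comp (f := pq) (g := (fst : PQ -> _))
    rz rpq pqc (strict_at_fst rpq rpz)).
have qc : strict_at q z.
  exact (strict_at_comp (f := pq) (g := (snd : PQ -> _))
    rz rpq pqc (strict_at_snd rpq rqz)).
have [zeta zetaE] := tsub z (u *m jac zM x).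
rewrite tmapE in zetaE.
have pLc := smooth_strict_at (p z) (@proj_smooth _ _ _ (vb_arr L)).
have pNc := smooth_strict_at (q z) (@proj_smooth _ _ _ (vb_obj L')).
have projp : proj (vb_arr L) (p z) = unt x by rewrite pzE proj_zero.
have projq : proj (vb_obj L') (q z) = y by rewrite zq proj_zero.
have ru := manifold_regular (unt x); have ry := manifold_regular y.
have jpc := strict_at_comp rz rpz pc pLc.
have jqc := strict_at_comp rz rqz qc pNc.
have jsrc : jac (proj (vb_arr L) \o p) z *m jac (@src R G) (unt x) =
    jac (proj (vb_obj L') \o q) z *m jac (on_obj f) y.
  have := jac_comp rz (manifold_regular _) jpc
    (smooth_strict_at _ (@src_smooth _ G)).
  have := jac_comp rz (manifold_regular _) jqc (smooth_strict_at _
    (on_obj_smooth f)).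
  rewrite /= projp projq => <- <-; congr (jac _ _); apply/funext => z' /=.
  rewrite -(fibrewise_proj (@src_linear _ L))
    -(fibrewise_proj (mor_obj_linear F)).
  have : [set w : arr (total L) * obj (total L') | src w.1 =
    on_obj tF w.2] (p z', q z').
    by rewrite -pqS; exists z'.
  by move=> /= ->.
have jtgt : jac (proj (vb_arr L) \o p) z *m jac (@tgt R G) (unt x) =
    jac (fun z => tgt (p z)) z *m jac (proj (vb_obj L)) (zM x).
  have := jac_comp rz (manifold_regular _) jpc
    (smooth_strict_at _ (@tgt_smooth _ G)).
  rewrite /= projp => <-.
  have tpc : strict_at (fun z => tgt (p z)) z.
    exact (strict_at_comp rz rpz pc (smooth_strict_at _ (@tgt_smooth _ _))).
  have tpz : tgt (p z) = zM x by rewrite zp tgt_unt.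
  rewrite -tpz -(jac_comp rz (manifold_regular _) tpc (smooth_strict_at _
    (@proj_smooth _ _ _ (vb_obj L)))).
  congr (jac _ _).
  by apply/funext => z' /=; rewrite (fibrewise_proj (@tgt_linear _ L)).
exists (zeta *m jac (proj (vb_arr L) \o p) z), (zeta *m jac (proj (vb_obj L')
  \o q) z).
split; first by rewrite -!mulmxA jsrc.
by rewrite -mulmxA jtgt mulmxA zetaE -mulmxA jac_proj_zero mulmx1.
Qed.

Lemma base_transverse y :
  row_full (jac (@arr_ends R H G) (anchor_incl f (unt y)) -
            jac (obj_ends f) (anchor_incl f (unt y))).
Proof.
set w := anchor_incl f (unt y); apply: row_full_surj => u.
have [a [v [sa ta]]] := base_submersion y (rsubmx u).
have [a' [v' [sa' ta']]] := base_submersion y (lsubmx u).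
exists (row_mx (a + a' *m jac (@inv R G) (unt (on_obj f y))) (row_mx v v')).
apply: etrans (mulmxBr _ _ _) _.
have E1 := jac_arr_ends w (a + a' *m jac (@inv R G) (unt (on_obj f y)))
  (row_mx v v').
have E2 := jac_obj_ends f w (a + a' *m jac (@inv R G) (unt (on_obj f y))) v v'.
apply: etrans (congr2 (fun p q => p - q) E1 E2) _.
rewrite /w /= on_arr_unt src_unt tgt_unt.
apply: etrans (transverse_ends (jac_inv_src _) (jac_inv_tgt _) sa sa') _.
by rewrite ta ta' hsubmxK.
Qed.

Lemma base_arrow_tangent y :
  exists D : 'M[R]_(cdim X, cdim (arr H)),
    jac (anchor_incl f) (unt y) *m D = 1%:M /\
    (forall (a : 'rV[R]_(cdim (arr G))) (v w : 'rV[R]_(cdim (obj H))),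
    a *m jac (@src R G) (unt (on_obj f y)) = v *m jac (on_obj f) y ->
    a *m jac (@tgt R G) (unt (on_obj f y)) = w *m jac (on_obj f) y ->
    row_mx a (row_mx v w) *m D *m jac (anchor_incl f) (unt y) =
      row_mx a (row_mx v w)).
Proof.
have [r [rc rjK jrK]] := base_retraction (unt y).
set j := anchor_incl f in rc rjK jrK *.
have [jD Dj] := fibre_product_tangent (manifold_regular _) (regular_prod3 _)
  (regular_prod _)
  (anchor_incl_strict f (unt y)) rc (arr_ends_strict _) (obj_ends_strict f _)
  (anchor_incl_ends f (unt y)) rjK jrK (base_transverse y).
exists (jac r (j (unt y))); split=> [|a v w av aw]; first exact: jD.
apply: Dj.
have := jac_arr_ends (anchor_incl f (unt y)) a (row_mx v w).
have := jac_obj_ends f (anchor_incl f (unt y)) a v w.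
rewrite /= on_arr_unt src_unt tgt_unt => E1 E2.
exact: etrans E2 (etrans (congr2 (@row_mx _ _ _ _) av aw) (esym E1)).
Qed.

(** This lemma and the next say that the tangent space of H at the unit of y is
    the fibre product of the tangent spaces. *)
Lemma base_arrow_tangent_inj y (a : 'rV[R]_(cdim (arr H))) :
  a *m jac (on_arr f) (unt y) = 0 -> a *m jac (@src R H) (unt y) = 0 ->
  a *m jac (@tgt R H) (unt y) = 0 -> a = 0.
Proof.
move=> af as_ at_; have [D [jD _]] := base_arrow_tangent y.
have : a *m jac (anchor_incl f) (unt y) = 0.
  by rewrite jac_anchor_incl !mul_mx_row af as_ at_ !row_mx0.
move=> /(congr1 (mulmx^~ D)) aj.
by rewrite -[a]mulmx1 -jD mulmxA aj mul0mx.
Qed.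

Lemma base_arrow_tangent_surj y (a : 'rV[R]_(cdim (arr G)))
    (v w : 'rV[R]_(cdim (obj H))) :
  a *m jac (@src R G) (unt (on_obj f y)) = v *m jac (on_obj f) y ->
  a *m jac (@tgt R G) (unt (on_obj f y)) = w *m jac (on_obj f) y ->
  exists b : 'rV[R]_(cdim (arr H)),
    [/\ b *m jac (on_arr f) (unt y) = a, b *m jac (@src R H) (unt y) = v
      & b *m jac (@tgt R H) (unt y) = w].
Proof.
move=> av aw; have [D [_ Dj]] := base_arrow_tangent y.
exists (row_mx a (row_mx v w) *m D).
have := Dj a v w av aw; rewrite jac_anchor_incl !mul_mx_row.
by move=> /eq_row_mx[-> /eq_row_mx[-> ->]].
Qed.

(** The vector given by [base_submersion] becomes tangent to the source fibre
    once the tangent vector of units with the same source is subtracted. *)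
Lemma base_tangent_split y (u : 'rV[R]_(cdim (obj G))) :
  exists (a : 'rV[R]_(cdim (arr G))) (v : 'rV[R]_(cdim (obj H))),
    a *m jac (@src R G) (unt (on_obj f y)) = 0 /\
    u = v *m jac (on_obj f) y + a *m jac (@tgt R G) (unt (on_obj f y)).
Proof.
have [a [v [sa ta]]] := base_submersion y u.
exists (a - v *m jac (on_obj f) y *m jac (@unt R G) (on_obj f y)), v.
rewrite !mulmxBl -!(mulmxA (v *m _)) jac_unt_src jac_unt_tgt mulmx1 sa ta subrr.
by rewrite addrC subrK.
Qed.

End Morita.

End BaseMaps.

(** * Cohomology of three-term complexes *)

Section Complexes.
Context {R : realType}.

Lemma coh_class_eqP (A B : lmodType R) (d : A -> B) b b' : linear d ->
  (coh_class d b = coh_class d b' <-> exists a, b = b' + d a).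
Proof.
move=> dl; split=> [bb'|[a ->]].
  have : coh_class d b b by exists 0 => //; rewrite (linear_map0 dl) addr0.
  by rewrite bb' => -[a _ <-]; exists a.
apply/seteqP; split=> x [c _ <-].
  by exists (a + c) => //; rewrite (linear_add _ _ dl) addrA.
by exists (c - a) => //; rewrite (linear_sub _ _ dl) -addrA [d a + _]addrC subrK.
Qed.

Lemma coh_map_class (A B A' B' : lmodType R) (d : A -> B) (e : A' -> B')
    (h : A -> A') (f : B -> B') b :
  linear d -> linear e -> linear f -> (forall a, f (d a) = e (h a)) ->
  coh_map e f (coh_class d b) = coh_class e (f b).
Proof.
move=> dl el fl fd; apply/seteqP; split=> x.
  move=> [_ [a _ <-]] [a' _ <-]; exists (h a + a') => //.
  by rewrite (linear_add _ _ el) (linear_add _ _ fl) fd addrA.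
move=> bx; exists b => //; exists 0 => //.
by rewrite (linear_map0 dl) addr0.
Qed.

(** The last two hypotheses are injectivity and surjectivity on cohomology, read
    on representatives. *)
Lemma cohomology_bij (A B C A' B' C' : lmodType R) (d : A -> B) (d' : B -> C)
    (e : A' -> B') (e' : B' -> C') (h : A -> A') (f : B -> B') :
  linear d -> linear d' -> linear e -> linear f ->
  (forall a, f (d a) = e (h a)) ->
  (forall b, d' b = 0 -> e' (f b) = 0) ->
  (forall b a', d' b = 0 -> f b = e a' -> exists a, b = d a) ->
  (forall b', e' b' = 0 -> exists b a', d' b = 0 /\ b' = f b + e a') ->
  set_bij (cohomology d d') (cohomology e e') (coh_map e f).
Proof.
move=> dl d'l el fl fd fker inj surj; have fcl b := coh_map_class b dl el fl fd.
split.
- by move=> _ [b bker <-]; rewrite fcl; exists (f b) => //; exact: fker.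
- move=> _ _ /set_mem[b bker <-] /set_mem[b' b'ker <-]; rewrite !fcl.
  move=> /(coh_class_eqP _ _ el)[a' fb].
  have d'bb' : d' (b - b') = 0 by rewrite (linear_sub _ _ d'l) bker b'ker subrr.
  have [|a bb'] := inj (b - b') a' d'bb'.
    by rewrite (linear_sub _ _ fl) fb addrC addKr.
  by apply/coh_class_eqP => //; exists a; rewrite -bb' addrC subrK.
- move=> _ [b' b'ker <-]; have [b [a' [bker b'E]]] := surj b' b'ker.
  exists (coh_class d b); first by exists b.
  by rewrite fcl; apply/esym/coh_class_eqP => //; exists a'.
Qed.

(** The hypotheses on the square in degrees -1 and 0 mean that
    0 -> cm1 C -> c0 C + cm1 D -> c0 D -> 0 is exact. *)
Lemma quasi_iso_criterion (C D : @triple R) (fm1 : cm1 C -> cm1 D)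
    (f0 : c0 C -> c0 D) (f1 : c1 C -> c1 D) :
  is_complex C -> is_complex D -> is_cochain_map fm1 f0 f1 ->
  (forall a, dm1 a = 0 -> fm1 a = 0 -> a = 0) ->
  (forall b a', f0 b = dm1 a' -> exists a, dm1 a = b /\ fm1 a = a') ->
  (forall b', exists b a', b' = f0 b + dm1 a') ->
  (forall c, f1 c = 0 -> c = 0) -> (forall c', exists c, f1 c = c') ->
  is_quasi_iso fm1 f0 f1.
Proof.
move=> cC cD cf inj cart cocart f1inj f1surj; split=> //.
all: have [dC d'C d'dC] := cC; have [dD d'D d'dD] := cD.
all: have [fm1l f0l f1l fd fd'] := cf.
all: have l0 (U : lmodType R) : linear (@from0 R U) /\ linear (@to0 R U)
  by split=> k u v; rewrite ?/from0 ?/to0 scaler0 addr0.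
- apply: (cohomology_bij (h := id)) => //.
  + by case: (l0 (cm1 C)).
  + by case: (l0 (cm1 D)).
  + by move=> a; rewrite /from0 (linear_map0 fm1l).
  + by move=> a da; rewrite -fd da (linear_map0 f0l).
  + move=> a a' da fa; exists 0; rewrite /from0; apply: inj => //.
  + move=> a' da'; have [|a [da fa]] := cart 0 a'.
      by rewrite da' (linear_map0 f0l).
    by exists a, 0; rewrite da fa /from0 addr0.
- apply: (cohomology_bij (h := fm1)) => //.
  + by move=> b db; rewrite -fd' db (linear_map0 f1l).
  + by move=> b a' bker /cart[a [<- _]]; exists a.
  + move=> b' db'; have [b [a' b'E]] := cocart b'; exists b, a'; split=> //.
    apply: f1inj; rewrite fd'; move: db'.
    by rewrite b'E (linear_add _ _ d'D) d'dD addr0.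
- apply: (cohomology_bij (h := f0)) => //.
  + by case: (l0 (c1 C)).
  + move=> c b' cker fc; have [b [a' b'E]] := cocart b'; exists b.
    apply/subr0_eq/f1inj; rewrite (linear_sub _ _ f1l) fc b'E fd'.
    by rewrite (linear_add _ _ d'D) d'dD addr0 subrr.
  + move=> c' _; have [c <-] := f1surj c'.
    by exists c, 0; rewrite (linear_map0 d'D) addr0.
Qed.

End Complexes.

(** * Line bundles *)

Section LineBundles.
Context {R : realType}.

Section RankOne.
Context {E B : manifold R} (V : vbundle E B) (rV : rank V = 1%N).

Lemma line_generator b : exists2 e : fib V b, e <> 0 &
  forall v, exists c, v = c *: e.
Proof.
have [U [phi [psi [[_ Ub] _ psiP phiK phil]]]] := local_trivialization V b.
pose T (v : fib V b) : 'rV[R]_(rank V) := phi (incl v).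
have Tl : linear T by exact: phil.
have Tinj : injective T.
  move=> v w vw; apply: (@incl_inj _ _ _ V b).
  by rewrite -[incl v]phiK ?proj_incl// -[incl w]phiK ?proj_incl//; congr psi;
    congr pair.
have [_ psib phib] := psiP b (const_mx 1) Ub.
have [e ee] := (projP V b _).1 psib.
have Te : T e = const_mx 1 by rewrite /T ee.
have i0 : 'I_(rank V) by rewrite rV; exact: ord0.
have iE (i : 'I_(rank V)) : i = i0.
  have ord_eq0 (k : 'I_(rank V)) : k = 0%N :> nat.
    by case: k => k /=; rewrite rV ltnS leqn0 => /eqP.
  by apply: ord_inj; rewrite !ord_eq0.
exists e => [e0|v].
  have := congr1 (fun r : 'rV_(rank V) => r 0 i0) Te.
  by rewrite e0 (linear_map0 Tl) !mxE => /eqP; rewrite eq_sym oner_eq0.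
exists (T v 0 i0); apply: Tinj.
have := Tl (T v 0 i0) e 0; rewrite addr0 (linear_map0 Tl) addr0 => ->.
by apply/rowP => i; rewrite (iE i) Te !mxE mulr1.
Qed.

End RankOne.

Section LineMaps.
Context {E B E' B' : manifold R} {V : vbundle E B} {V' : vbundle E' B'}.
Context (rV : rank V = 1%N) (rV' : rank V' = 1%N).
Context {b : B} {b' : B'} (T : {linear fib V b -> fib V' b'}).

Lemma line_map_inj : (forall w, exists v, T v = w) -> forall v, T v = 0 -> v = 0.
Proof.
move=> surj v; have [e _ eP] := line_generator rV b; have [c ->] := eP v.
have [e' e'0 _] := line_generator rV' b'.
rewrite linearZ => /eqP; rewrite scaler_eq0 => /orP[/eqP->|/eqP Te].
  by rewrite scale0r.
have [w Tw] := surj e'; have [k wE] := eP w; case: e'0.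
by rewrite -Tw wE linearZ Te; exact: scaler0.
Qed.

Lemma line_map_surj : (forall v, T v = 0 -> v = 0) -> forall w, exists v, T v = w.
Proof.
move=> inj w; have [e e0 _] := line_generator rV b.
have [e' _ e'P] := line_generator rV' b'.
have [c Te] := e'P (T e); have [k ->] := e'P w.
have c0 : c != 0 by apply/eqP => c0; apply/e0/inj; rewrite Te c0 scale0r.
by exists ((k / c) *: e); rewrite linearZ Te /= scalerA divfK.
Qed.

End LineMaps.

Lemma fib_invK (E B E' B' : manifold R) (V : vbundle E B) (V' : vbundle E' B')
    (F : E -> E') (f : B -> B') (x : B) (w : fib V' (f x)) :
  (exists v : fib V x, F (incl v) = incl w) -> F (incl (fib_inv V F w)) = incl w.
Proof.
by move=> [v vw]; rewrite /fib_inv; case: xgetP => [u _ //|/(_ v)].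
Qed.

Lemma pullbackE (E B E' B' : manifold R) (V : vbundle E B) (V' : vbundle E' B')
    (F : E -> E') (f : B -> B') (theta : preform V') x v :
  pullback V F f theta x v = fib_inv V F (theta (f x) (v *m jac f x)).
Proof. by rewrite /pullback tmapE. Qed.

Section LBG.
Context (L : vbGroupoid R) (hL : is_lbg L).

Lemma src_unt_fibre x (w : fib (vb_obj L) (src (unt x))) :
  exists v : fib (vb_arr L) (unt x), src (incl v) = incl w.
Proof.
have : proj (vb_arr L) (unt (incl w)) = unt x.
  by rewrite (fibrewise_proj (@unt_linear _ L)) proj_incl src_unt.
by move=> /projP[v vE]; exists v; rewrite vE src_unt.
Qed.

Lemma tgt_unt_fibre x (w : fib (vb_obj L) (tgt (unt x))) :
  exists v : fib (vb_arr L) (unt x), tgt (incl v) = incl w.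
Proof.
have : proj (vb_arr L) (unt (incl w)) = unt x.
  by rewrite (fibrewise_proj (@unt_linear _ L)) proj_incl tgt_unt.
by move=> /projP[v vE]; exists v; rewrite vE tgt_unt.
Qed.

(** The units show that src maps the fibre over a unit onto the fibre over its
    source; both are lines. *)
Lemma src_unt_inj x (v : fib (vb_arr L) (unt x)) :
  src (incl v) = zero_section (vb_obj L) (src (unt x)) -> v = 0.
Proof.
have [S SE] := @src_linear _ L (unt x); rewrite SE => /incl_eq_zero.
apply: line_map_inj; [exact: hL.1|exact: hL.2|move=> w].
have [u uw] := src_unt_fibre w; exists u; apply: (@incl_inj _ _ _ (vb_obj L)).
by rewrite -SE.
Qed.

(** At the unit of x, s^*theta vanishes on a because ds a = 0 and s is injective
    on the line over the unit.  Hence so does t^*theta, whose value on a is sent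
    by t to theta (dt a). *)
Lemma closed_anchor (theta : preform (vb_obj L)) (x : obj (base L)) a :
  (forall x, linear (theta x)) -> (forall g v, coboundary theta g v = 0) ->
  a *m jac (@src R (base L)) (unt x) = 0 ->
  theta x (a *m jac (@tgt R (base L)) (unt x)) = 0.
Proof.
move=> thl closed sa; have : fib_inv (vb_arr L) (@src R (total L))
      (theta (src (unt x)) (a *m jac (@src R (base L)) (unt x))) -
    fib_inv (vb_arr L) (@tgt R (total L))
      (theta (tgt (unt x)) (a *m jac (@tgt R (base L)) (unt x))) = 0.
  apply: etrans (closed (unt x) a).
  exact: (congr2 (fun p q => p - q)
    (esym (@pullbackE _ _ _ _ _ _ _ _ theta (unt x) a))
    (esym (@pullbackE _ _ _ _ _ _ _ _ theta (unt x) a))).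
rewrite sa.
set w := theta (tgt _) _; rewrite (linear_map0 (thl _)).
set u := fib_inv _ _ 0; set v := fib_inv _ _ w.
have u0 : u = 0.
  apply: src_unt_inj; apply: fib_invK; exact: src_unt_fibre.
rewrite u0 sub0r => /eqP; rewrite oppr_eq0 => /eqP v0.
have : tgt (incl v) = incl w by apply: fib_invK; exact: tgt_unt_fibre.
rewrite v0 [tgt _](fibrewise_zero (@tgt_linear _ L)) => /esym/incl_eq_zero.
suff tr x' : x' = x -> theta x' (a *m jac (@tgt R (base L)) (unt x)) = 0 ->
  theta x (a *m jac (@tgt R (base L)) (unt x)) = 0 by apply: tr; exact: tgt_unt.
by move=> ->.
Qed.

End LBG.

Section LineMorita.
Context {L' L : vbGroupoid R} (hL' : is_lbg L') (F : vbgMorphism L' L)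
  (hF : is_vb_morita F).
Let f := mor_base F.
Let tF := mor_total F.

(** If F l = 0, the unit of the zero vector over f y and the pair (0, l)
    determine an arrow e of L' with source 0 and target l.  It lies over the
    unit of y, where a vector with source 0 vanishes; hence so does its target
    l. *)
Lemma morita_fibre_inj y (l : fib (vb_obj L') y) :
  on_obj tF (incl l) = zero_section (vb_obj L) (on_obj f y) -> l = 0.
Proof.
set zM := zero_section (vb_obj L); set zN := zero_section (vb_obj L') => Fl.
set x := on_obj f y in Fl.
have zy : on_obj tF (zN y) = zM x by rewrite (fibrewise_zero (mor_obj_linear F)).
have [[_ _ jS _] _] := hF.
pose w : arr (total L) * (obj (total L') * obj (total L')) :=
  (unt (zM x), (zN y, incl l)).
have : [set w : arr (total L) * (obj (total L') * obj (total L')) |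
    (src w.1, tgt w.1) = (on_obj tF w.2.1, on_obj tF w.2.2)] w.
  by rewrite /= src_unt tgt_unt zy Fl.
rewrite -jS => -[e _ [eF es et]].
have pe : proj (vb_arr L') e = unt y.
  apply: (base_anchor_incl_inj hF).
  rewrite /anchor_incl -(fibrewise_proj (mor_arr_linear F)) eF.
  rewrite -(fibrewise_proj (@src_linear _ L')) es
    -(fibrewise_proj (@tgt_linear _ L')) et.
  rewrite (fibrewise_zero (@unt_linear _ L)) !proj_zero proj_incl.
  by rewrite on_arr_unt src_unt tgt_unt.
have [v ve] := (projP _ _ _).1 pe.
have v0 : v = 0 by apply: (src_unt_inj hL'); rewrite ve es src_unt.
apply: incl_eq_zero; rewrite -et -ve v0.
by rewrite [tgt _](fibrewise_zero (@tgt_linear _ L')) tgt_unt.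
Qed.

End LineMorita.

End LineBundles.

(** * Invariance of the Morita kernel *)

Theorem proposition5p2p6 (R : realType) (L' L : vbGroupoid R)
    (hL' : is_lbg L') (hL : is_lbg L)
    (F : vbgMorphism L' L) (hF : is_vb_morita F)
    (theta : preform (vb_obj L)) (htheta : is_form theta)
    (hclosed : forall g v, coboundary theta g v = 0)
    (y : obj (base L')) :
  exists (phi : {linear subvs_of (algebroid y) ->
                        subvs_of (algebroid (on_obj (mor_base F) y))})
         (psi : {linear fib (vb_obj L') y ->
                        fib (vb_obj L) (on_obj (mor_base F) y)}),
    [/\ forall a, vsval (phi a) = tmap (on_arr (mor_base F)) (unt y) (vsval a),
        forall l : fib (vb_obj L') y,
          on_obj (mor_total F) (incl l) = incl (psi l)
      & is_quasi_iso
          (C := morita_kernel (pullback_obj F theta) y)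
          (D := morita_kernel theta (on_obj (mor_base F) y))
          phi (tmap (on_obj (mor_base F)) y) psi].
Proof.
set f := mor_base F; set x := on_obj f y.
have algP (K : lieGroupoid R) (z : obj K) a :
    (a \in algebroid z) = (a *m jac (@src R K) (unt z) == 0).
  by rewrite memv_ker lfunE /= tmapE.
have algE (K : lieGroupoid R) (z : obj K) (a : subvs_of (algebroid z)) :
    vsval a *m jac (@src R K) (unt z) = 0.
  by apply/eqP; rewrite -algP; exact: subvsP.
pose phi : {linear subvs_of (algebroid y) -> subvs_of (algebroid x)} :=
  vsproj (algebroid x) \o (tmap (on_arr f) (unt y) \o vsval).
have phiE a : vsval (phi a) = tmap (on_arr f) (unt y) (vsval a).
  rewrite /= vsprojK// algP tmapE -mulmxA jac_on_arr_src mulmxA algE.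
  by apply/eqP; exact: mul0mx.
have [psi psiE] := mor_obj_linear F y.
have psi_inj l : psi l = 0 -> l = 0.
  by move=> l0; apply: (morita_fibre_inj hL' hF); rewrite psiE l0.
have psi_surj := line_map_surj hL'.2 hL.2 psi_inj.
have thl := htheta.1.
have psith v : psi (pullback_obj F theta y v) = theta x (tmap (on_obj f) y v).
  apply: (@incl_inj _ _ _ (vb_obj L)); rewrite -psiE.
  apply: fib_invK; have [l lE] := psi_surj (theta x (tmap (on_obj f) y v)).
  by exists l; rewrite psiE lE.
have psi_inj2 : injective psi.
  by move=> k l kl; apply/subr0_eq/psi_inj; rewrite linearB kl subrr.
have anchorE (K : lieGroupoid R) (z : obj K) (a : subvs_of (algebroid z)) :
    anchor a = vsval a *m jac (@tgt R K) (unt z).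
  by rewrite /anchor tmapE.
have fanchor a : tmap (on_obj f) y (anchor a) = anchor (phi a).
  by rewrite !anchorE phiE !tmapE -!mulmxA jac_on_arr_tgt.
have th_anchor (a : subvs_of (algebroid x)) : theta x (anchor a) = 0.
  by rewrite anchorE; apply: closed_anchor.
have anchor_linear (K : lieGroupoid R) (z : obj K) : linear (@anchor R K z).
  by move=> k a b; rewrite /anchor !linearP.
have th'l : linear (pullback_obj F theta y).
  move=> k u v; apply: psi_inj2; rewrite linearP !psith linearP.
  exact: thl.
exists phi, psi; split=> //.
have th'_anchor (a : subvs_of (algebroid y)) : pullback_obj F theta y (anchor
  a) = 0.
  apply: psi_inj; apply: etrans (psith _) _.
  exact: etrans (congr1 (theta x) (fanchor a)) (th_anchor _).
have phi_jac a : vsval (phi a) = vsval a *m jac (on_arr f) (unt y).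
  exact: etrans (phiE a) (tmapE _ _ _).
apply: quasi_iso_criterion.
- by split; [exact: anchor_linear|exact: th'l|exact: th'_anchor].
- by split; [exact: anchor_linear|exact: thl|exact: th_anchor].
- by split; [exact: linearP|exact: linearP|exact: linearP|exact: fanchor|exact:
  psith].
- move=> a a0 pa0; apply: val_inj.
  apply: (base_arrow_tangent_inj hF); first
    by apply: etrans (esym (phi_jac a)) _; rewrite pa0 linear0.
    exact: algE.
  exact: etrans (esym (anchorE _ _ _)) a0.
  (* The triple (a, 0, v) solves the linearised equations of the fibre product;
     the source component 0 puts the solution in the Lie algebroid. *)
- move=> v a va.
  have [||b [bf bs bt]] := base_arrow_tangent_surj hF (y := y) (a := vsval a)
    (v := 0) (w := v).
  + by rewrite algE mul0mx.
  + by rewrite -anchorE -[LHS]va tmapE.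
  have balg : b \in algebroid y by rewrite algP bs.
  exists (vsproj _ b); split; first by apply: etrans (anchorE _ _ _) _;
    rewrite vsprojK.
  by apply: val_inj; apply: etrans (phi_jac _) _; rewrite vsprojK.
- move=> u; have [a [v [as0 uE]]] := base_tangent_split hF y u.
  have aalg : a \in algebroid x by rewrite algP as0.
  exists v, (vsproj _ a); apply: etrans uE _; rewrite tmapE; congr (_ + _).
  by apply/esym; apply: etrans (anchorE _ _ _) _; rewrite vsprojK.
- exact: psi_inj.
- exact: psi_surj.
Qed.
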